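(* Assume that $\nabla f$ is $\ell$-Lipschitz continuous for some $\ell>0$, that $\delta:[t_0,+\infty)\to(0,+\infty)$ is continuously differentiable and nondecreasing, and that $$\alpha>3,\qquad \beta\ge 0,\qquad \tfrac12>\theta>\tfrac{1}{\alpha-1},\qquad \sup_{t\ge t_0}\frac{t\dot\delta(t)}{\delta(t)}<\frac{1-2\theta}{\theta}.$$ Let $(x,\lambda):[t_0,+\infty)\to\mathcal X\times\mathcal Y$ be a solution of the dynamical system (DS) and let $(x_*,\lambda_* )\in\mathbb S$. Then $(x(t),\lambda(t))$ converges weakly in $\mathcal X\times\mathcal Y$, as $t\to+\infty$, to a primal-dual optimal solution of the problem of minimizing $f(x)$ subject to $Ax=b$, i.e. to an element of $\mathbb S$.
   Context: Let $\mathcal X,\mathcal Y$ be real Hilbert spaces; $\mathcal X\times\mathcal Y$ carries the product inner product and norm. Let $f:\mathcal X\to\mathbb R$ be convex and continuously differentiable, $A:\mathcal X\to\mathcal Y$ a continuous linear operator with adjoint $A^*$, and $b\in\mathcal Y$. The Lagrangian is $\mathcal L(x,\lambda)=f(x)+\langle\lambda,Ax-b\rangle$. $\mathbb S$ denotes the set of saddle points of $\mathcal L$ (primal-dual optimal solutions), equivalently the set of $(x_*,\lambda_* )\in\mathcal X\times\mathcal Y$ with $\nabla f(x_* )+A^*\lambda_*=0$ and $Ax_*=b$; it is assumed nonempty. Given $t_0>0$, $\alpha>0$, $\theta>0$, $\beta\ge0$, a function $\delta$, and initial data $(x_0,\lambda_0),(\dot x_0,\dot\lambda_0)\in\mathcal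 X\times\mathcal Y$, the dynamical system (DS) is, for $t\ge t_0$, $$\ddot x(t)+\frac\alpha t\dot x(t)+\delta(t)\nabla f(x(t))+\delta(t)A^*\big(\lambda(t)+\theta t\dot\lambda(t)\big)+\delta(t)\beta A^*(Ax(t)-b)=0,$$ $$\ddot\lambda(t)+\frac\alpha t\dot\lambda(t)-\delta(t)\Big(A\big(x(t)+\theta t\dot x(t)\big)-b\Big)=0,$$ with $(x(t_0),\lambda(t_0))=(x_0,\lambda_0)$ and $(\dot x(t_0),\dot\lambda(t_0))=(\dot x_0,\dot\lambda_0)$. A solution is a twice continuously differentiable pair $(x,\lambda)$ satisfying this. *)

(* Defs.v *)
From HB Require Import structures.
From mathcomp Require Import all_boot all_order all_algebra sesquilinear.
From mathcomp Require Import all_classical all_reals all_analysis.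

Set Implicit Arguments.
Unset Strict Implicit.
Unset Printing Implicit Defensive.

Import Order.TTheory GRing.Theory Num.Theory.
Import numFieldNormedType.Exports.

Local Open Scope classical_set_scope.
Local Open Scope ring_scope.

(* Real Hilbert spaces: complete normed modules over the reals whose norm is
   the one induced by a positive definite symmetric bilinear form. *)
HB.mixin Record CompleteNormedModule_isHilbert (R : realType) (T : Type)
    of CompleteNormedModule R T := {
  inner : {dot T for @idfun R} ;
  inner_normE : forall u : T, inner u u = `|u| ^+ 2
}.

#[short(type="hilbertType")]
HB.structure Definition Hilbert (R : realType) :=
  {T of CompleteNormedModule_isHilbert R T & CompleteNormedModule R T}.

Notation "'<| u , v |>" := (inner u v)
  (at level 0, format "''<|' u ,  v '|>'") : ring_scope.

Section Operators.
Variable R : realType.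

(* The Riesz representative of the differential of f at x; the value is only
   meaningful where f is differentiable. *)
Definition gradient (X : hilbertType R) (f : X -> R) (x : X) : X :=
  get [set g : X | forall h : X, 'd f x h = '<| g, h |>].

(* The adjoint of a continuous linear operator, which exists and is unique by
   the Riesz theorem. *)
Definition adjoint (X Y : hilbertType R) (A : X -> Y) (y : Y) : X :=
  get [set v : X | forall u : X, '<| A u, y |> = '<| u, v |>].

(* The inner product of the Hilbert space product; the norm that the library
   puts on X * Y is the (equivalent) max norm. *)
Definition prod_inner (X Y : hilbertType R) (z w : X * Y) : R :=
  '<| z.1, w.1 |> + '<| z.2, w.2 |>.

Definition weakly_cvg_prod (X Y : hilbertType R) (z : R -> X * Y)
    (zoo : X * Y) : Prop :=
  forall w : X * Y, prod_inner (z t) w @[t --> +oo] --> prod_inner zoo w.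

End Operators.

Section DerivativeOnSet.
Variables (R : realType) (V : normedModType R).

(* Differentiation relative to a set D of times, i.e. only increments inside D
   are used. On D = [t0, +oo[ this is the ordinary derivative at interior points
   and the right derivative at t0, so the values of a function outside D are
   irrelevant. *)
Definition diff_quotient (x : R -> V) (t s : R) : V :=
  (s - t)^-1 *: (x s - x t).

Definition derivable_in (D : set R) (x : R -> V) (t : R) : Prop :=
  cvg (diff_quotient x t @ within D t^').

Definition derive_in (D : set R) (x : R -> V) (t : R) : V :=
  lim (diff_quotient x t @ within D t^').

Definition C1_on (D : set R) (x : R -> V) : Prop :=
  (forall t, D t -> derivable_in D x t) /\ {within D, continuous (derive_in D x)}.

Definition C2_on (D : set R) (x : R -> V) : Prop :=
  (forall t, D t -> derivable_in D x t) /\ C1_on D (derive_in D x).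

End DerivativeOnSet.

Section PrimalDual.
Variables (R : realType) (X Y : hilbertType R).
Variables (f : X -> R) (A : {linear X -> Y}) (b : Y).

Definition lagrangian (x : X) (lam : Y) : R := f x + '<| lam, A x - b |>.

Definition saddle_points : set (X * Y) :=
  [set z | forall (x : X) (lam : Y),
     lagrangian z.1 lam <= lagrangian z.1 z.2 /\
     lagrangian z.1 z.2 <= lagrangian x z.2].

Variables (t0 alpha theta beta : R) (delta : R -> R).

Definition DS_solution (x0 : X) (lam0 : Y) (dx0 : X) (dlam0 : Y)
    (x : R -> X) (lam : R -> Y) : Prop :=
  let D := `[t0, +oo[%classic in
  let dx := derive_in D x in
  let ddx := derive_in D dx in
  let dlam := derive_in D lam in
  let ddlam := derive_in D dlam in
  [/\ C2_on D x, C2_on D lam,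
      forall t, t0 <= t ->
        ddx t + (alpha / t) *: dx t + delta t *: gradient f (x t)
        + delta t *: adjoint A (lam t + (theta * t) *: dlam t)
        + (delta t * beta) *: adjoint A (A (x t) - b) = 0,
      forall t, t0 <= t ->
        ddlam t + (alpha / t) *: dlam t
        - delta t *: (A (x t + (theta * t) *: dx t) - b) = 0 &
      [/\ x t0 = x0, lam t0 = lam0, dx t0 = dx0 & dlam t0 = dlam0]].

End PrimalDual.

(* Main.v *)
Require Import Defs.
From HB Require Import structures.
From mathcomp Require Import all_boot all_order all_algebra sesquilinear.
From mathcomp Require Import all_classical all_reals all_analysis.
From mathcomp Require Import ring lra.

(** The proof is a Lyapunov argument followed by Opial's lemma.

    Fix a saddle point (xs, ls), put z = (x, lam), zs = (xs, ls), and let F(t) >= 0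
    be the gap of the augmented Lagrangian between (x(t), ls) and (xs, lam(t)).
    Consider
      E = theta t^2 (delta F + |z'|^2 / 2) + (alpha - 1) |z - zs|^2 / 2
          + t <z - zs, z'>.
    Since theta (alpha - 1) > 1, theta E is a sum of nonnegative terms
    (energy_split).
    Differentiating E along the system, the skew terms that couple x and lam
    cancel: both equations use the same extrapolation theta t.  The convexity of f
    and the growth bound on delta then give t E' <= - c t^2 (delta F + |z'|^2 / 2)
    with c > 0 (energy_dissipation).  Hence z and t z' are bounded,
    F = O(1 / (t^2 delta)), and by cocoercivity of the gradient of f,
    gradient f (x(t)) tends to gradient f xs.

    The distance to every saddle point converges (anchor_cvg): W = |z - zs|^2 / 2
    satisfies t W' + (alpha - 1) W = E - q, where E converges and q >= 0 is
    controlled by - t E'.  Comparison for Euler-type differential inequalities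
    is enough to conclude, and no integration is involved (dissipation_cvg).

    Weak cluster points are saddle points (weak_cluster_saddle).  Tested against a
    fixed vector, each equation says that a scalar g satisfies
    (t phi' + (alpha - 1) phi)' = t delta (g + theta t g' + o(1)) with phi and
    t phi' bounded, which forces g to tend to 0 (forced_decay).  This yields that
    A x - b and the image of lam - ls under the adjoint of A tend weakly to 0.  As F
    tends to 0, the x-component of a weak cluster point also minimizes the
    Lagrangian at ls.

    Opial's lemma then gives the weak limit (opial).  Weak compactness is needed
    only along ultrafilters, where it reduces to the Riesz representation theorem
    (riesz), which also provides the gradient and the adjoint. *)

Set Implicit Arguments.
Unset Strict Implicit.
Unset Printing Implicit Defensive.

Import Order.TTheory GRing.Theory Num.Theory.
Import numFieldNormedType.Exports.

Local Open Scope classical_set_scope.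
Local Open Scope ring_scope.

(** * Inner products *)

Section InnerAlgebra.
Variables (R : realType) (H : hilbertType R).
Implicit Types (u v w : H) (a : R).

Lemma innerC u v : '<| u, v |> = '<| v, u |>.
Proof. by rewrite (@hermC R false idfun H (inner : {dot H for idfun})) expr0 mul1r. Qed.

Lemma innerDl u v w : '<| u + v, w |> = '<| u, w |> + '<| v, w |>.
Proof. exact: linearDl. Qed.

Lemma innerDr u v w : '<| w, u + v |> = '<| w, u |> + '<| w, v |>.
Proof. exact: linearDr. Qed.

Lemma innerNl u w : '<| - u, w |> = - '<| u, w |>.
Proof. exact: linearNl. Qed.

Lemma innerNr u w : '<| w, - u |> = - '<| w, u |>.
Proof. exact: linearNr. Qed.

Lemma innerZl a u w : '<| a *: u, w |> = a * '<| u, w |>.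
Proof. exact: linearZl_LR. Qed.

Lemma innerZr a u w : '<| w, a *: u |> = a * '<| w, u |>.
Proof. by rewrite innerC innerZl innerC. Qed.

Lemma inner0l w : '<| 0, w |> = 0.
Proof. exact: linear0l. Qed.

Lemma inner0r w : '<| w, 0 |> = 0.
Proof. exact: linear0r. Qed.

Definition innerE := (innerDl, innerDr, innerNl, innerNr, innerZl, innerZr).

Lemma inner_ge0 u : 0 <= '<| u, u |>.
Proof. by rewrite inner_normE exprn_ge0. Qed.

Lemma inner_eq0 u : ('<| u, u |> == 0) = (u == 0).
Proof. by rewrite inner_normE sqrf_eq0 normr_eq0. Qed.

Lemma inner_eq u v : (forall w, '<| u, w |> = '<| v, w |>) -> u = v.
Proof.
move=> uv; apply/eqP; rewrite -subr_eq0 -inner_eq0 innerDl innerNl.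
by rewrite uv subrr.
Qed.

Lemma cauchy_schwarz u v : `|'<| u, v |>| <= `|u| * `|v|.
Proof.
suff cs (x y : H) : '<| x, y |> <= `|x| * `|y|.
  by rewrite ler_norml cs andbT lerNl -innerNl (le_trans (cs _ _)) ?normrN.
have := inner_ge0 (`|y| *: x - `|x| *: y).
rewrite !innerE !inner_normE (innerC y x).
have [->|x0] := eqVneq x 0; first by rewrite inner0l normr0 mul0r.
have [->|y0] := eqVneq y 0; first by rewrite inner0r normr0 mulr0.
have {}x0 : 0 < `|x| by rewrite normr_gt0.
have {}y0 : 0 < `|y| by rewrite normr_gt0.
have xy : 0 < `|x| * `|y| by exact: mulr_gt0.
move=> h; rewrite -(ler_pM2l xy).
by move: h; set i := inner _ _; nra.
Qed.

Lemma inner_polar u v : '<| u, v |> = 4^-1 * (`|u + v| ^+ 2 - `|u - v| ^+ 2).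
Proof. by rewrite -!inner_normE !innerE (innerC v u); field. Qed.

Lemma inner_cvg T (F : set_system T) {FF : Filter F} (p q : T -> H) u v :
  p @ F --> u -> q @ F --> v -> '<| p t, q t |> @[t --> F] --> '<| u, v |>.
Proof.
move=> pu qv; rewrite inner_polar; under eq_fun do rewrite inner_polar.
by apply: cvgM; [exact: cvg_cst|apply: cvgB; rewrite expr2;
  under eq_fun do rewrite expr2; apply: cvgM; apply: cvg_norm;
  first [exact: cvgB | exact: cvgD]].
Qed.

End InnerAlgebra.

(** * The Riesz representation *)

Section Riesz.
Variables (R : realType).

(** A quadratic polynomial that vanishes and is minimal at 0 has no linear term:
    first-order optimality without differentiating. *)
Lemma linear_coef_eq0 (a c : R) : (forall s, 0 <= s * a + s ^+ 2 * c) -> a = 0.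
Proof.
move=> h; have h1 : 0 <= - a ^+ 2.
  (* a step this short makes the linear term dominate the quadratic one *)
  have h0 := h (- a / (`|c| + 1)).
  have c0 : 0 < `|c| + 1 by rewrite ltr_wpDl.
  have cc := ler_norm c.
  move: h0; set k := (`|c| + 1)^-1.
  have k0 : 0 < k by rewrite invr_gt0.
  have kc : k * (`|c| + 1) = 1 by rewrite mulVf// gt_eqF.
  have kc1 : k * c <= 1 - k by move: (ler_wpM2l (ltW k0) cc) => ?; nra.
  have -> : - a * k * a + (- a * k) ^+ 2 * c = k * a ^+ 2 * (k * c - 1) by ring.
  move=> h2; have a2 : 0 <= a ^+ 2 by exact: sqr_ge0.
  have : k * (k * a ^+ 2) <= 0 by nra.
  by rewrite pmulr_rle0// pmulr_rle0// oppr_ge0.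
by apply/eqP; rewrite -sqrf_eq0 eq_le sqr_ge0 -oppr_ge0 h1.
Qed.

Variable H : hilbertType R.

(** The representative of phi minimizes J u = |u|^2 / 2 - phi u.  By the
    parallelogram identity |u - v|^2 <= 4 (J u - m + J v - m) with m the infimum of
    J, so a minimizing sequence is Cauchy. *)
Theorem riesz (phi : {linear H -> R^o}) : continuous phi ->
  exists g : H, forall h, phi h = '<| g, h |>.
Proof.
move=> cphi.
have [M M0 Mphi] : exists2 M : R, 0 <= M & forall h, `|phi h| <= M * `|h|.
  have /linear_boundedP : bounded_near phi (nbhs (0:H)).
    by apply/linear_bounded_continuous.
  move=> [M [_ hM]]; exists (`|M| + 1); first by rewrite addr_ge0.
  by apply: hM; rewrite (le_lt_trans (ler_norm _))// ltrDl.
have phiZ a h : phi (a *: h) = a * phi h by exact: (linearZ_LR phi).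
have phiD h k : phi (h + k) = phi h + phi k by exact: (linearD phi).
pose J (u : H) : R := 2^-1 * '<| u, u |> - phi u.
have Jlb u : - (2^-1 * M ^+ 2) <= J u.
  rewrite /J inner_normE; have := Mphi u; rewrite ler_norml => /andP[_].
  by have := sqr_ge0 (`|u| - M); nra.
have infJ : has_inf (range J).
  by split; [exists (J 0), 0|exists (- (2^-1 * M ^+ 2)) => _ [u _ <-]].
set m := inf (range J).
have mJ u : m <= J u by apply: ge_inf; [case: infJ|exists u].
have par u v : '<| u - v, u - v |> <= 4 * ((J u - m) + (J v - m)).
  have := mJ (2^-1 *: (u + v)); rewrite /J phiZ phiD !innerE (innerC v u); lra.
have adh n : exists u, J u < m + n.+1%:R^-1.
  have [_ [u _ <-] hu] := @inf_adherent _ (range J) n.+1%:R^-1 (ltac:(by rewrite invr_gt0)) infJ.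
  by exists u.
have [u_ hu] := choice adh.
have ucvg : cvg (u_ @ \oo).
  apply/cauchy_cvgP/cauchy_ballP => /= e; move: (e : R) => {}e e0.
  have e80 : 0 < e ^+ 2 / 8 by rewrite divr_gt0// exprn_gt0.
  have hn : \forall n \near \oo, n.+1%:R^-1 < e ^+ 2 / 8.
    by near=> n; near: n; apply: near_infty_natSinv_lt (PosNum e80).
  have : \forall p \near (\oo, \oo), p.1.+1%:R^-1 < e ^+ 2 / 8 /\ p.2.+1%:R^-1 < e ^+ 2 / 8.
    by exists ([set n | n.+1%:R^-1 < e ^+ 2 / 8], [set n | n.+1%:R^-1 < e ^+ 2 / 8]).
  rewrite near_simpl /=; apply: filterS => -[i j] /= [hi hj]; rewrite -ball_normE /=.
  rewrite -(@ltr_pXn2r _ 2) ?nnegrE ?normr_ge0 ?(ltW e0)// -inner_normE.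
  apply: le_lt_trans (par _ _) _.
  move: hi hj (hu i) (hu j); move: (i.+1%:R^-1) (j.+1%:R^-1) (e ^+ 2) => a c d.
  lra.
pose u := lim (u_ @ \oo).
have uu : u_ @ \oo --> u by [].
have Ju : J u <= m.
  have c1 : J (u_ n) @[n --> \oo] --> J u.
    apply: cvgB; last by apply: continuous_cvg; [exact: cphi|exact: uu].
    by apply: cvgM; [exact: cvg_cst|exact: inner_cvg].
  have c2 : m + n.+1%:R^-1 @[n --> \oo] --> m + 0.
    by apply: cvgD; [exact: cvg_cst|exact: cvg_harmonic].
  rewrite -[leRHS]addr0; apply: ler_cvg_to c1 c2 _.
  by apply: nearW => n; exact: ltW.
exists u => h; apply/eqP; rewrite eq_sym -subr_eq0; apply/eqP.
apply: (@linear_coef_eq0 _ (2^-1 * '<| h, h |>)) => s.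
have := le_trans Ju (mJ (u + s *: h)).
rewrite /J phiD phiZ !innerE (innerC h u).
by move: ('<| u, h |>) ('<| u, u |>) ('<|h, h|>) (phi u) (phi h) => *; nra.
Unshelve. all: by end_near. Qed.

End Riesz.

(** * Adjoints and gradients *)

Section AdjointGradient.
Variables (R : realType) (X Y : hilbertType R).

Lemma adjointE (A : {linear X -> Y}) u y : continuous A ->
  '<| A u, y |> = '<| u, adjoint A y |>.
Proof.
move=> cA.
have lin : linear (fun u : X => '<| A u, y |> : R^o).
  by move=> a v w; rewrite linearP innerDl innerZl.
pose phi : {linear X -> R^o} :=
  HB.pack (fun u : X => '<| A u, y |> : R^o) (GRing.isLinear.Build _ _ _ _ _ lin).
have [|g hg] := @riesz _ _ phi.
  by move=> v; apply: inner_cvg; [exact: cA|exact: cvg_cst].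
have : exists v : X, forall u, '<| A u, y |> = '<| u, v |>.
  by exists g => v; rewrite (innerC v) -hg.
by move=> /getPex; exact.
Qed.

Lemma gradientE (f : X -> R) x h : differentiable f x ->
  'd f x h = '<| gradient f x, h |>.
Proof.
move=> df; have /getPex : exists g : X, forall h, 'd f x h = '<| g, h |>.
  by apply: riesz; exact: diff_continuous.
exact.
Qed.

End AdjointGradient.

(** * Derivatives along curves *)

Section Curves.
Variable R : realType.
Implicit Types t : R.

(** At an interior time of D the relative derivative is the ordinary one.  All
    estimates below are carried out on the open half-line, so that the one-sided
    derivative at the initial time never intervenes. *)
Lemma derive_in_is_derive (V : normedModType R) (D : set R) (x : R -> V) t :
  nbhs t D -> derivable_in D x t -> is_derive t 1 x (derive_in D x t).
Proof.
move=> Dt; rewrite /derivable_in /derive_in.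
have -> : within D t^' = t^'.
  apply/seteqP; split => B /= hB; last first.
    by apply: filterS hB => s Bs _.
  rewrite /dnbhs /within /= in hB *; apply: filterS2 Dt hB => s Ds hs st.
  exact: hs.
have E : diff_quotient x t @ t^' =
    (fun h => h^-1 *: ((x \o shift t) (h *: 1) - x t)) @ 0^'.
  rewrite predeqE => B.
  have E0 := near_shift 0 t (fun s => s != t -> B (diff_quotient x t s)).
  rewrite subr0 in E0.
  transitivity (\forall s \near t, s != t -> B (diff_quotient x t s)) => //.
  rewrite E0; split => P; apply: (@filterS _ (nbhs (0 : R)) _ _ _ _ P) => h /=;
    rewrite /diff_quotient addrK [h *: 1]mulr1 => hB h0; apply: hB;
    move: h0; by rewrite -[h + t == t]subr_eq0 addrK.
by rewrite E => cx; apply: DeriveDef.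
Qed.

Lemma is_derive_inner (H : hilbertType R) (u v : R -> H) t du dv :
  is_derive t 1 u du -> is_derive t 1 v dv ->
  is_derive t 1 (fun s => '<| u s, v s |>) ('<| du, v t |> + '<| u t, dv |>).
Proof.
move=> hu hv.
have [hu1 hu2] := hu; have [hv1 hv2] := hv.
have c : (fun h : R => h^-1 *: (((fun s => '<| u s, v s |>) \o shift t) (h *: 1)
    - '<| u t, v t |>)) @ 0^' --> '<| du, v t |> + '<| u t, dv |>.
  rewrite -hu2 -hv2.
  have cv : v (h *: 1 + t) @[h --> 0^'] --> v t.
    have cv : {for t, continuous v}.
      by apply/differentiable_continuous/derivable1_diffP.
    apply: (cvg_comp (fun h : R => h *: 1 + t) v) cv.
    apply: cvg_trans (_ : (fun h : R => h *: 1 + t) @ 0 --> t).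
      by apply: cvg_app; exact: nbhs_dnbhs.
    rewrite -[X in _ --> X]add0r -[X in _ --> X + _](scale0r (1:R)).
    by apply: cvgD; [apply: cvgZr_tmp; exact: cvg_id|exact: cvg_cst].
  pose g (h : R) := '<| h^-1 *: (u (h *: 1 + t) - u t), v (h *: 1 + t) |> +
    '<| u t, h^-1 *: (v (h *: 1 + t) - v t) |>.
  suff -> : (fun h : R => h^-1 *: (((fun s => '<| u s, v s |>) \o shift t) (h *: 1)
    - '<| u t, v t |>)) = g.
    exact: cvgD (inner_cvg hu1 cv) (inner_cvg (cvg_cst (u t)) hv1).
  apply: funext => h; rewrite /g /= !innerE /GRing.scale /=.
  ring.
apply: DeriveDef; first by apply/cvg_ex; eexists; exact: c.
by apply: cvg_lim => //; exact: c.
Qed.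

Lemma is_derive_comp_gradient (H : hilbertType R) (f : H -> R) (x : R -> H) t dx :
  is_derive t 1 x dx -> differentiable f (x t) ->
  is_derive t 1 (f \o x) '<| gradient f (x t), dx |>.
Proof.
move=> hx df.
have dfx : differentiable x t by apply/derivable1_diffP; case: hx.
have dd : differentiable (f \o x) t by exact: differentiable_comp.
apply: DeriveDef; first exact/derivable1_diffP.
by case: hx => _ <-; rewrite deriveE// diff_comp//= -gradientE// deriveE.
Qed.

Lemma is_derive_line (H : normedModType R) (u h : H) t :
  is_derive t 1 (fun s : R => u + s *: h) h.
Proof.
have d : is_derive t 1 ((cst u : R -> H) + ( *:%R^~ h)) (0 + h).
  apply: is_deriveD; apply: DeriveDef; last by rewrite deriveE// diff_val scale1r.
  by apply/derivable1_diffP.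
by rewrite add0r in d.
Qed.

Lemma le_of_derive (a b : R) (y dy : R -> R) : a <= b ->
  (forall t, a <= t <= b -> is_derive t 1 y (dy t)) ->
  (forall t, a <= t <= b -> dy t <= 0) -> y b <= y a.
Proof.
move=> ab hy hd.
have [c cab E] : exists2 c, c \in `[a, b] & y b - y a = dy c * (b - a).
  apply: MVT_segment => //.
    by move=> c; rewrite in_itv /= => /andP[ac cb]; apply: hy; rewrite !ltW.
  by apply: derivable_within_continuous => c; rewrite in_itv /= => /hy[].
rewrite -subr_le0 E mulr_le0_ge0 ?subr_ge0// hd//.
Qed.

Section ScalarRules.
Variables (y z : R -> R) (t dy dz : R).
Hypotheses (hy : is_derive t 1 y dy) (hz : is_derive t 1 z dz).

Lemma is_derive_add : is_derive t 1 (fun s => y s + z s) (dy + dz).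
Proof. exact: is_deriveD. Qed.

Lemma is_derive_opp : is_derive t 1 (fun s => - y s) (- dy).
Proof. exact: is_deriveN. Qed.

Lemma is_derive_mul : is_derive t 1 (fun s => y s * z s) (dy * z t + y t * dz).
Proof. by apply: is_derive_eq (is_deriveM hy hz) _; rewrite /GRing.scale /=; ring. Qed.

Lemma is_derive_scale c : is_derive t 1 (fun s => c * y s) (c * dy).
Proof. exact: is_deriveZ. Qed.

Lemma is_derive_inv : y t != 0 -> is_derive t 1 (fun s => (y s)^-1) (- dy / y t ^+ 2).
Proof.
case: hy => d <- y0; apply: DeriveDef; first exact: derivableV.
by rewrite deriveV// /GRing.scale /=; field.
Qed.

End ScalarRules.

Lemma is_derive_var t : is_derive t (1 : R) (fun s => s) 1.
Proof. exact: is_derive_id. Qed.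

End Curves.

Lemma is_derive_linear (R : realType) (X Y : hilbertType R) (A : {linear X -> Y})
    (x : R -> X) (t : R) dx : continuous A ->
  is_derive t 1 x dx -> is_derive t 1 (A \o x) (A dx).
Proof.
move=> cA hx.
have dx1 : differentiable x t by apply/derivable1_diffP; case: hx.
have dA u : differentiable A u by exact: linear_differentiable.
apply: DeriveDef; first by apply/derivable1_diffP; exact: differentiable_comp.
case: hx => _ <-; rewrite deriveE; last exact: differentiable_comp.
by rewrite diff_comp//= diff_lin//= deriveE.
Qed.

Lemma is_derive_half_sqr (R : realType) (H : hilbertType R) (u : R -> H) (t : R) (du : H) :
  is_derive t 1 u du -> is_derive t 1 (fun s => 2^-1 * '<| u s, u s |>) '<| u t, du |>.
Proof.
move=> hu; apply: is_derive_eq (is_derive_scale (is_derive_inner hu hu) 2^-1) _.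
by rewrite (innerC du); field.
Qed.

Lemma is_derive_subc (R : realType) (H : normedModType R) (u : R -> H) (t : R) (du c : H) :
  is_derive t 1 u du -> is_derive t 1 (fun s => u s - c) du.
Proof.
move=> hu; have := is_deriveB hu (is_derive_cst c t 1).
by rewrite subr0.
Qed.

Lemma derive_ge0_of_homo (R : realType) (y : R -> R) (a t : R) (dy : R) : a < t ->
  {in `[a, +oo[ &, {homo y : s r / s <= r}} -> is_derive t 1 y dy -> 0 <= dy.
Proof.
move=> at_ hy [d <-].
have h := cvg_dnbhs_at_right d.
apply: (closed_cvg (fun r : R => 0 <= r) _ _ _ h); first exact: closed_ge.
near=> s; have s0 : 0 < s by [].
rewrite /= [s%:A]mulr1 -[_ *: (_ : R)]/(_ * _) pmulr_rge0 ?invr_gt0// subr_ge0.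
by apply: hy; rewrite ?in_itv /= ?andbT; lra.
Unshelve. all: by end_near. Qed.

(** * Smooth convex functions *)

Section SmoothConvex.
Variables (R : realType) (H : hilbertType R) (f : H -> R).
Hypothesis f_diff : forall u, differentiable f u.
Implicit Types u v h : H.

Lemma is_derive_along u h s :
  is_derive s (1 : R) (fun r : R => f (u + r *: h)) '<| gradient f (u + s *: h), h |>.
Proof. exact: (is_derive_comp_gradient (is_derive_line u h s)). Qed.

(** The secant slopes from u towards v are at most f v - f u, and they tend to the
    directional derivative. *)
Lemma convex_above_tangent u v : convex_function (E := H) setT f ->
  f u + '<| gradient f u, v - u |> <= f v.
Proof.
move=> fc; rewrite -lerBrDl.
have sec (s : R) : 0 < s -> s <= 1 ->
    s^-1 * (f (u + s *: (v - u)) - f u) <= f v - f u.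
  move=> s0 s1; rewrite ler_pdivrMl//.
  have := fc (Itv01 (ltW s0) s1) v u (in_setT _) (in_setT _).
  rewrite convRE /= /conv /= /unstable.onem.
  have -> : s *: v + (1 - s) *: u = u + s *: (v - u).
    by rewrite scalerBl scale1r scalerBr addrCA.
  lra.
have [d E] := is_derive_along u (v - u) 0.
move: E d; rewrite scale0r addr0 /derive /derivable => <- d.
apply: (@ler_cvg_to _ (at_right 0) _ _ (fun h : R => h^-1 *:
   (((fun r => f (u + r *: (v - u))) \o shift 0) (h *: 1) - f (u + 0 *: (v - u))))
   (fun=> f v - f u)).
- exact: cvg_dnbhs_at_right d.
- exact: cvg_cst.
near=> s; rewrite /= [s%:A]mulr1 addr0 scale0r addr0; apply: sec => //.
by near: s; exact: nbhs_right_le.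
Unshelve. all: by end_near. Qed.

Variable l : R.
Hypothesis l_gt0 : 0 < l.
Hypothesis f_lip : l.-lipschitz (gradient f).

(** Along the segment from u to v, f minus its quadratic model at u has
    derivative at most 0 by the Lipschitz bound and Cauchy-Schwarz. *)
Lemma descent u v :
  f v <= f u + '<| gradient f u, v - u |> + l / 2 * `|v - u| ^+ 2.
Proof.
pose h := v - u.
pose y (s : R) := f (u + s *: h) + (- '<| gradient f u, h |> * s +
  - (l / 2 * `|h| ^+ 2) * (s * s)).
pose dy (s : R) := '<| gradient f (u + s *: h), h |> + (- '<| gradient f u, h |> * 1 +
  - (l / 2 * `|h| ^+ 2) * (1 * s + s * 1)).
have : y 1 <= y 0.
  apply: (@le_of_derive _ _ _ _ dy) => // s.
    move=> _; exact: is_derive_add (is_derive_along _ _ _) (is_derive_add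
      (is_derive_scale (is_derive_var _) _)
      (is_derive_scale (is_derive_mul (is_derive_var _) (is_derive_var _)) _)).
  move=> /andP[s0 _]; rewrite /dy.
  have := @f_lip (u + s *: h, u) (conj I I); rewrite /=.
  have -> : u + s *: h - u = s *: h by rewrite addrAC subrr add0r.
  move: (gradient f (u + s *: h)) (gradient f u) => p q.
  rewrite normrZ (ger0_norm s0) => /(ler_wpM2r (normr_ge0 h)).
  have := le_trans (ler_norm _) (cauchy_schwarz (p - q) h).
  rewrite innerDl innerNl expr2; lra.
by rewrite /y scale1r scale0r addr0 /h [u + (v - u)]addrC subrK; lra.
Qed.

(** Combine the tangent at u with the descent inequality along a gradient step
    from v of length 1/l. *)
Lemma gradient_gap u v : convex_function (E := H) setT f ->
  (2 * l)^-1 * `|gradient f v - gradient f u| ^+ 2 <=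
  f v - f u - '<| gradient f u, v - u |>.
Proof.
move=> fc; set g := gradient f v - gradient f u.
have := descent v (v - l^-1 *: g).
have := convex_above_tangent u (v - l^-1 *: g) fc.
rewrite /g; move: {g} (gradient f u) (gradient f v) => p q; set g := q - p.
rewrite [v - _ - u]addrAC [v - _ - v]addrAC subrr add0r normrN normrZ.
rewrite (gtr0_norm (_ : 0 < l^-1)) ?invr_gt0//.
rewrite !(innerDr (v - u)) !innerNr !innerZr.
have : `|g| ^+ 2 = '<| q, g |> - '<| p, g |>.
  by rewrite -inner_normE {1}/g innerDl innerNl.
have -> : l / 2 * (l^-1 * `|g|) ^+ 2 = (2 * l)^-1 * `|g| ^+ 2 by field; rewrite gt_eqF.
have -> : l^-1 = 2 * (2 * l)^-1 by field; rewrite gt_eqF.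
move: (`|g| ^+ 2) '<| q, g |> '<| p, g |> => n a c ->.
lra.
Qed.

End SmoothConvex.

(** * Asymptotics of scalar differential inequalities *)

Section ScalarAsymptotics.
Variable R : realType.
Implicit Types (y dy k e W dW de q : R -> R) (t mu c l m T kinf : R).

Lemma near_pinftyP (P : set R) :
  (\forall t \near +oo, P t) <-> exists T, 0 < T /\ forall t, T <= t -> P t.
Proof.
split=> [[M [_ hM]]|[T [_ hT]]].
  exists (`|M| + 1); split=> [|t ht]; first by rewrite ltr_wpDl.
  by apply: hM; rewrite (lt_le_trans _ ht)// (le_lt_trans (ler_norm M))// ltrDl.
by exists T; split=> [|t /ltW/hT//]; exact: num_real.
Qed.

Lemma cvg0_of_le_inv (r : R -> R) C :
  (\forall t \near +oo, `|r t| <= C / t) -> r t @[t --> +oo] --> (0 : R).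
Proof.
move=> hr; apply/cvgr0Pnorm_le => e e0; near=> t.
have t0 : 0 < t by near: t; exact: nbhs_pinfty_gt.
apply: (@le_trans _ _ (C / t)); first by near: t.
rewrite ler_pdivrMr// mulrC -ler_pdivrMr//; near: t.
Unshelve. all: by end_near. Qed.

Lemma is_derive_expR_ln (mu t : R) : 0 < t ->
  is_derive t 1 (fun s => expR (mu * ln s)) (expR (mu * ln t) * (mu / t)).
Proof.
move=> t0.
have d1 : is_derive t 1 (fun s => mu * ln s) (mu * t^-1).
  by apply: is_derive_scale; exact: is_derive1_ln.
by apply: is_derive_eq; rewrite /GRing.scale /= mulrC.
Qed.

(** Multiplying by the integrating factor t^mu turns the left-hand side into a
    derivative, so y - kinf / mu is eventually at least minus a multiple of t^-mu. *)
Lemma euler_comparison mu y dy k kinf : 0 < mu ->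
  (\forall t \near +oo, is_derive (t : R) 1 y (dy t)) ->
  (\forall t \near +oo, k t <= t * dy t + mu * y t) ->
  k t @[t --> +oo] --> kinf ->
  forall eps : R, 0 < eps -> \forall t \near +oo, kinf / mu - eps <= y t.
Proof.
move=> mu0 hy hk kc eps eps0.
have me0 : 0 < mu * eps / 2 by rewrite divr_gt0// mulr_gt0.
have hk2 : \forall t \near +oo, kinf - mu * eps / 2 <= k t.
  move/cvgrPdist_le: kc => /(_ _ me0); apply: filterS => t.
  by rewrite ler_distlC => /andP[].
have /near_pinftyP[T [T0 hT]] : \forall t \near +oo,
    is_derive (t : R) 1 y (dy t) /\ kinf - mu * eps / 2 <= t * dy t + mu * y t.
  by apply: filterS3 hy hk hk2 => t ? h1 h2; split=> //; exact: le_trans h1.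
pose c := kinf / mu - eps / 2.
pose p (t : R) := expR (mu * ln t).
have p0 t : 0 < p t by exact: expR_gt0.
have pmono t : T <= t -> p T * (y T - c) <= p t * (y t - c).
  move=> Tt; rewrite -lerN2.
  apply: (@le_of_derive _ _ _ (fun t => - (p t * (y t - c)))
    (fun t => - (p t * (mu / t) * (y t - c) + p t * (dy t + 0)))) => // s /andP[Ts _].
    have s0 : 0 < s by exact: lt_le_trans Ts.
    exact: is_derive_opp (is_derive_mul (is_derive_expR_ln mu s0)
      (is_derive_add (hT s Ts).1 (is_derive_cst _ _ _))).
  have s0 : 0 < s by exact: lt_le_trans Ts.
  have [_ h] := hT s Ts.
  rewrite oppr_le0 -mulrA -mulrDr pmulr_rge0//.
  rewrite -(pmulr_rge0 _ s0) addr0 mulrDr.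
  have -> : s * (mu / s * (y s - c)) = mu * (y s - c) by field; rewrite gt_eqF.
  rewrite mulrBr /c mulrBr.
  have -> : mu * (kinf / mu) = kinf by field; rewrite gt_eqF.
  lra.
pose K := `|p T * (y T - c)|.
near=> t.
have Tt : T <= t by near: t; apply: nbhs_pinfty_ge; exact: num_real.
have pt : 2 * K / eps <= p t.
  apply: le_trans (expR_ge1Dx _); apply: ler_wpDl => //.
  rewrite -ler_pdivrMl// -ler_expR lnK; last by rewrite posrE (lt_le_trans T0).
  by near: t; apply: nbhs_pinfty_ge; exact: num_real.
have h1 : - K <= p t * (y t - c).
  by rewrite (le_trans _ (pmono _ Tt))// lerNl /K -normrN ler_norm.
have h2 : K <= p t * (eps / 2).
  by move: pt; rewrite ler_pdivrMr//; lra.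
have : 0 <= p t * (y t - c + eps / 2) by rewrite mulrDr; lra.
rewrite pmulr_rge0// /c; lra.
Unshelve. all: by end_near. Qed.

Lemma cvg_of_eventually_between y l :
  (forall eps : R, 0 < eps -> \forall t \near +oo, l - eps <= y t) ->
  (forall eps : R, 0 < eps -> \forall t \near +oo, y t <= l + eps) ->
  y t @[t --> +oo] --> l.
Proof.
move=> lo hi; apply/cvgrPdist_le => e e0.
near=> t; rewrite distrC ler_distl; apply/andP; split.
  by near: t; exact: lo.
by near: t; exact: hi.
Unshelve. all: by end_near. Qed.

Lemma euler_cvg mu y dy k kinf : 0 < mu ->
  (\forall t \near +oo, is_derive (t : R) 1 y (dy t)) ->
  (\forall t \near +oo, t * dy t + mu * y t = k t) ->
  k t @[t --> +oo] --> kinf -> y t @[t --> +oo] --> kinf / mu.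
Proof.
move=> mu0 hy hk kc; apply: cvg_of_eventually_between => eps e0.
  apply: euler_comparison e0 => //; [exact: hy| |exact: kc].
  by apply: filterS hk => t ->.
have : \forall t \near +oo, - kinf / mu - eps <= - y t.
  apply: (@euler_comparison _ _ (fun t => - dy t) (fun t => - k t)) e0 => //.
  - by apply: filterS hy => t; exact: is_derive_opp.
  - by apply: filterS hk => t <-; rewrite !mulrN opprD.
  - exact: cvgN.
by apply: filterS => t; rewrite mulNr lerNr opprD !opprK.
Qed.

(** Here q is only known to be integrable against dt / t, through the decrease
    of e.  The upper bound drops q; for the lower bound, W - e / c satisfies an
    inequality from which q has disappeared. *)
Lemma dissipation_cvg mu c W dW e de q l : 0 < mu -> 0 < c ->
  (\forall t \near +oo, is_derive (t : R) 1 W (dW t)) ->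
  (\forall t \near +oo, is_derive (t : R) 1 e (de t)) ->
  (\forall t \near +oo, t * dW t + mu * W t = e t - q t) ->
  (\forall t \near +oo, 0 <= q t) ->
  (\forall t \near +oo, t * de t <= - (c * q t)) ->
  e t @[t --> +oo] --> l -> W t @[t --> +oo] --> l / mu.
Proof.
move=> mu0 c0 hW he hWe hq hde ec; apply: cvg_of_eventually_between => eps e0.
  pose b := 1 + mu * - c^-1.
  have h : \forall t \near +oo, b * l / mu - eps / 2 <= W t + - c^-1 * e t.
    apply: (@euler_comparison _ _ (fun t => dW t + - c^-1 * de t)
      (fun t => b * e t)) => //; last 2 first.
    - by apply: cvgM => //; exact: cvg_cst.
    - lra.
    - apply: filterS2 hW he => t ? ?.
      exact: is_derive_add _ (is_derive_scale _ _).
    - apply: filterS2 hWe hde => t h1 h2; rewrite /b.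
      have : q t <= t * (- c^-1 * de t).
        have -> : t * (- c^-1 * de t) = c^-1 * - (t * de t) by ring.
        by rewrite ler_pdivlMl//; lra.
      move: h1; lra.
  have /cvgrPdist_le/(_ (c * (eps / 2))) := ec.
  move=> /(_ (ltac:(rewrite mulr_gt0//; lra))).
  apply: filterS2 h => t h1; rewrite ler_distlC => /andP[h2 _].
  have {}h2 : c^-1 * l - eps / 2 <= c^-1 * e t.
    rewrite -(ler_pM2l c0) mulrBr !mulrA divff ?gt_eqF// !mul1r.
    by move: h2; rewrite mulrA.
  have E : b * l / mu = l / mu - c^-1 * l.
    by rewrite /b; field; rewrite !gt_eqF.
  lra.
have : \forall t \near +oo, - l / mu - eps <= - W t.
  apply: (@euler_comparison _ _ (fun t => - dW t) (fun t => - e t)) e0 => //.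
  - by apply: filterS hW => t; exact: is_derive_opp.
  - by apply: filterS2 hWe hq => t h1 h2; move: h1; lra.
  - exact: cvgN.
by apply: filterS => t; rewrite mulNr lerNr opprD !opprK.
Qed.

Lemma nonincreasing_is_cvg y m T :
  (forall s t, T <= s -> s <= t -> y t <= y s) ->
  (forall t, T <= t -> m <= y t) -> exists l, y t @[t --> +oo] --> l.
Proof.
move=> ym yl; pose z t := - y (Num.max T t).
have zc : z t @[t --> +oo] --> sup (range z).
  apply: nondecreasing_cvgr => [s t st|].
    rewrite /z lerN2; apply: ym; first by rewrite le_max lexx.
    by rewrite ge_max !le_max lexx st orbT.
  by exists (- m) => _ [t _ <-]; rewrite /z lerN2 yl// le_max lexx.
exists (- sup (range z)).
apply: cvg_trans (cvgN zc); apply: near_eq_cvg.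
near=> t; rewrite /z/= opprK max_r//; near: t; apply: nbhs_pinfty_ge; exact: num_real.
Unshelve. all: by end_near. Qed.

(** With B := t phi' + (alpha - 1) phi one has B' = t delta (g + theta t g' + e),
    so u := g - B / (theta t^2 delta) solves u + theta t u' = o(1), the error
    being - e plus bounded terms over t^2 delta. *)
Lemma forced_decay (phi phi1 phi2 g g1 e delta ddelta : R -> R)
    (alpha theta tau d0 M : R) : 0 < theta -> 0 < d0 ->
  (\forall t \near +oo, is_derive (t : R) 1 phi (phi1 t)) ->
  (\forall t \near +oo, is_derive (t : R) 1 phi1 (phi2 t)) ->
  (\forall t \near +oo, is_derive (t : R) 1 g (g1 t)) ->
  (\forall t \near +oo, is_derive (t : R) 1 delta (ddelta t)) ->
  (\forall t \near +oo, d0 <= delta t) ->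
  (\forall t \near +oo, 0 <= t * ddelta t <= tau * delta t) ->
  (\forall t \near +oo, `|phi t| <= M) ->
  (\forall t \near +oo, `|t * phi1 t| <= M) ->
  (\forall t \near +oo, phi2 t + alpha / t * phi1 t =
    delta t * (g t + theta * t * g1 t) + delta t * e t) ->
  e t @[t --> +oo] --> (0 : R) -> g t @[t --> +oo] --> (0 : R).
Proof.
move=> th0 d00 hphi hphi1 hg hdel hd0 htau hM hM1 eqn ec.
pose B t := t * phi1 t + (alpha - 1) * phi t.
pose dB t := (1 * phi1 t + t * phi2 t) + (alpha - 1) * phi1 t.
pose w t := theta * (t * t * delta t).
pose dw t := theta * ((1 * t + t * 1) * delta t + t * t * ddelta t).
pose C := M + `|alpha - 1| * M.
have B_le : \forall t \near +oo, `|B t| <= C.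
  apply: filterS2 hM hM1 => t h1 h2; apply: le_trans (ler_normD _ _) _.
  by rewrite lerD// normrM ler_wpM2l.
have w_gt0 : \forall t \near +oo, 0 < w t.
  apply: filterS2 hd0 (nbhs_pinfty_gt (num_real 0)) => t h1 t0.
  by rewrite /w !mulr_gt0//; exact: lt_le_trans h1.
have Bw0 : B t / w t @[t --> +oo] --> (0 : R).
  apply: (@cvg0_of_le_inv _ (C / (theta * d0))).
  apply: filterS3 B_le hd0 (nbhs_pinfty_ge (num_real 1)) => t h1 h2 t1.
  have t0 : 0 < t by exact: lt_le_trans t1.
  have C0 : 0 <= C by exact: le_trans h1.
  have w0 : theta * d0 * t <= w t.
    rewrite /w -mulrA ler_pM2l// mulrC ler_pM ?(ltW t0) ?(ltW d00)// ler_peMl// ltW//.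
  have w1 : 0 < theta * d0 * t by rewrite !mulr_gt0.
  rewrite normrM normfV (ger0_norm (ltW (lt_le_trans w1 w0))).
  rewrite -[leRHS]mulrA -invfM ler_pM// ?invr_ge0 ?(ltW (lt_le_trans w1 w0))//.
  by rewrite lef_pV2 ?posrE// (lt_le_trans w1).
pose u t := g t + - (B t * (w t)^-1).
pose du t := g1 t + - (dB t * (w t)^-1 + B t * (- dw t / w t ^+ 2)).
suff u0 : u t @[t --> +oo] --> (0 : R).
  have -> : g = (fun t => u t + B t / w t) by apply: funext => t; rewrite subrK.
  by rewrite -[X in _ --> X]addr0; exact: cvgD.
pose r t := B t / w t * (2 + t * ddelta t / delta t - theta^-1).
have r0 : r t @[t --> +oo] --> (0 : R).
  apply/cvgr0Pnorm_le => eps e0.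
  pose K := 2 + `|tau| + theta^-1.
  have K0 : 0 < K by rewrite addr_gt0 ?invr_gt0// ltr_wpDr.
  have /cvgr0Pnorm_le/(_ (eps / K)) := Bw0.
  move=> /(_ (ltac:(by rewrite divr_gt0))).
  apply: filterS3 hd0 htau => t h1 /andP[h2 h3] h4.
  have dl0 : 0 < delta t by exact: lt_le_trans h1.
  rewrite /r normrM -[leRHS](divfK (lt0r_neq0 K0)) ler_pM//.
  have h5 : 0 <= t * ddelta t / delta t by rewrite divr_ge0// ltW.
  have h6 : t * ddelta t / delta t <= tau by rewrite ler_pdivrMr.
  have h7 := ler_norm tau; have h8 : 0 < theta^-1 by rewrite invr_gt0.
  by rewrite ler_norml /K; apply/andP; split; lra.
have -> : 0 = (theta^-1 * (- 0 + theta * 0)) / theta^-1 :> R.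
  by rewrite oppr0 mulr0 addr0 mulr0 mul0r.
apply: (@euler_cvg _ _ du (fun t => theta^-1 * (- e t + theta * r t))).
- by rewrite invr_gt0.
- near=> t.
  have w0 : w t != 0 by rewrite gt_eqF//; near: t.
  have d1 : is_derive t 1 phi (phi1 t) by near: t.
  have d2 : is_derive t 1 phi1 (phi2 t) by near: t.
  have d3 : is_derive t 1 g (g1 t) by near: t.
  have d4 : is_derive t 1 delta (ddelta t) by near: t.
  have dv := is_derive_var t.
  have dBt : is_derive t 1 B (dB t).
    exact: is_derive_add (is_derive_mul dv d2) (is_derive_scale d1 _).
  have dwt : is_derive t 1 w (dw t).
    exact: is_derive_scale (is_derive_mul (is_derive_mul dv dv) d4) _.
  exact: is_derive_add d3 (is_derive_opp (is_derive_mul dBt (is_derive_inv dwt w0))).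
- near=> t.
  have t0 : 0 < t by near: t; apply: nbhs_pinfty_gt; exact: num_real.
  have dl0 : 0 < delta t by apply: lt_le_trans d00 _; near: t.
  have E : phi2 t + alpha / t * phi1 t =
    delta t * (g t + theta * t * g1 t) + delta t * e t by near: t.
  have EB : dB t = t * (delta t * (g t + theta * t * g1 t) + delta t * e t).
    by rewrite -E /dB; field; rewrite gt_eqF.
  rewrite /du EB /u /r /dw /w; field.
  by rewrite !gt_eqF.
- apply: cvgM; first exact: cvg_cst.
  by apply: cvgD; [exact: cvgN|apply: cvgM => //; exact: cvg_cst].
Unshelve. all: by end_near. Qed.

End ScalarAsymptotics.

(** * Weak limits along ultrafilters *)

Section WeakLimits.
Variable R : realType.

(** Weak compactness enters only in this form: along an ultrafilter every scalar
    product of a bounded family converges, and the limits form a bounded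
    functional, which Riesz turns into a vector. *)
Lemma ultra_weak_limit (H : hilbertType R) T (U : set_system T) (z : T -> H) M :
  UltraFilter U -> (\forall t \near U, `|z t| <= M) ->
  exists p : H, forall w, '<| z t, w |> @[t --> U] --> '<| p, w |>.
Proof.
move=> UU zM.
have [t0 zt0] := filter_ex zM; have M0 : 0 <= M by exact: le_trans zt0.
have bnd w : \forall t \near U, `|'<| z t, w |>| <= M * `|w|.
  apply: filterS zM => t h; apply: le_trans (cauchy_schwarz _ _) _.
  by rewrite ler_wpM2r.
have ex w : exists l : R, '<| z t, w |> @[t --> U] --> l.
  have cK : compact `[- (M * `|w|), M * `|w|] by exact: segment_compact.
  have UK : (fmap (fun t => '<| z t, w |>) U) `[- (M * `|w|), M * `|w|]%classic.
    by apply: filterS (bnd w) => t; rewrite /= in_itv /= ler_norml.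
  have [l [_ cl]] := cK _ _ UK.
  exists l => B lB.
  have [//|UnB] := in_ultra_setVsetC ((fun t => '<| z t, w |>) @^-1` B) UU.
  have [r [/= nBr Br]] := cl (~` B) B UnB lB.
  exact: absurd.
have [L hL] := choice ex.
have Llin : linear (L : H -> R^o).
  move=> a u v; apply: (@cvg_unique _ (@Rhausdorff R) (fmap (fun t => '<| z t, a *: u + v |>) U)).
    exact: hL.
  have -> : (fun t => '<| z t, a *: u + v |>) =
      (fun t => a * '<| z t, u |> + '<| z t, v |>).
    by apply: funext => t; rewrite innerDr innerZr.
  exact: cvgD (cvgM (cvg_cst a) (hL u)) (hL v).
pose phi : {linear H -> R^o} :=
  HB.pack (L : H -> R^o) (GRing.isLinear.Build _ _ _ _ (L : H -> R^o) Llin).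
have LM w : `|L w| <= M * `|w|.
  apply: (closed_cvg (fun r : R => r <= M * `|w|) _ (bnd w) _ (cvg_norm (hL w))).
  exact: closed_le.
have phic : continuous phi.
  apply/linear_bounded_continuous/linear_boundedP.
  exists M; split=> [|r Mr w]; first exact: num_real.
  by rewrite (le_trans (LM w))// ler_wpM2r// ltW.
have [p hp] := riesz phic.
by exists p => w; rewrite -hp; exact: hL.
Qed.

(** If g^-1(B) is not in F for a neighborhood B of a, some ultrafilter extends both
    F and the complement of g^-1(B). *)
Lemma cvg_of_ultra T (V : topologicalType) (F : set_system T) (g : T -> V) (a : V) :
  ProperFilter F ->
  (forall U, UltraFilter U -> F `<=` U -> g @ U --> a) -> g @ F --> a.
Proof.
move=> FF hU B aB; apply: contrapT => nFB.
have PW : ProperFilter (within (~` (g @^-1` B)) F).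
  apply: Build_ProperFilter_ex => C hC; apply: contrapT => nC.
  apply: nFB; apply: (@filterS _ F _ _ _ _ hC) => t {}hC; apply: contrapT => ngB.
  by apply: nC; exists t; exact: hC.
have [U [UU WU]] := ultraFilterLemma PW.
have FU : F `<=` U.
  by move=> C FC; apply: WU; apply: (@filterS _ F _ _ _ _ FC) => t.
have UB : U (g @^-1` B) by exact: (hU U UU FU).
have UnB : U (~` (g @^-1` B)) by apply: WU; apply: (@filterS _ F _ setT) => //; exact: filterT.
have [t [? ?]] := filter_ex (filterI UB UnB).
by [].
Qed.

Section Opial.
Variables (X Y : hilbertType R) (x : R -> X) (lam : R -> Y) (S : set (X * Y)).

(** Opial's argument.  For p, q in S the function <z(t), p - q> converges, being
    an affine combination of squared distances; evaluating its limit along two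
    ultrafilters with weak limits p and q gives <p, p - q> = <q, p - q>. *)
Theorem opial (M : R) :
  (\forall t \near +oo, `|x t| <= M) -> (\forall t \near +oo, `|lam t| <= M) ->
  (forall p, S p -> exists l : R,
     (`|x t - p.1| ^+ 2 + `|lam t - p.2| ^+ 2) @[t --> +oo] --> l) ->
  (forall (U : set_system R) p, UltraFilter U -> +oo%R `<=` U ->
     (forall w, '<| x t, w |> @[t --> U] --> '<| p.1, w |>) ->
     (forall w, '<| lam t, w |> @[t --> U] --> '<| p.2, w |>) -> S p) ->
  exists2 p, S p & weakly_cvg_prod (fun t => (x t, lam t)) p.
Proof.
move=> xM lamM dist clus.
have lim (U : set_system R) : UltraFilter U -> +oo%R `<=` U -> exists p : X * Y,
   [/\ (forall w, '<| x t, w |> @[t --> U] --> '<| p.1, w |>),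
     (forall w, '<| lam t, w |> @[t --> U] --> '<| p.2, w |>) & S p].
  move=> UU FU.
  have [p1 h1] := ultra_weak_limit UU (FU _ xM).
  have [p2 h2] := ultra_weak_limit UU (FU _ lamM).
  by exists (p1, p2); split=> //; exact: (clus U).
have [U0 [UU0 FU0]] := ultraFilterLemma (proper_pinfty_nbhs : ProperFilter (pinfty_nbhs R)).
have [p [px pl Sp]] := lim U0 UU0 FU0.
exists p => // w; apply: cvg_of_ultra => U UU FU.
have [q [qx ql Sq]] := lim U UU FU.
suff -> : p = q by apply: cvgD; [exact: qx|exact: ql].
have [lp hlp] := dist p Sp; have [lq hlq] := dist q Sq.
pose c := - 2^-1 * (lp - lq - ('<| p.1, p.1 |> + '<| p.2, p.2 |>)
   + ('<| q.1, q.1 |> + '<| q.2, q.2 |>)).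
have hc : ('<| x t, p.1 - q.1 |> + '<| lam t, p.2 - q.2 |>) @[t --> +oo] --> c.
  have := cvgM (cvg_cst (- 2^-1 : R)) (cvgD (cvgB (cvgB hlp hlq)
    (cvg_cst ('<| p.1, p.1 |> + '<| p.2, p.2 |>)))
    (cvg_cst ('<| q.1, q.1 |> + '<| q.2, q.2 |>))).
  move=> h.
  set k := fun t : R => _.
  suff -> : k = (fun t => - 2^-1 * (
    (`|x t - p.1| ^+ 2 + `|lam t - p.2| ^+ 2) -
    (`|x t - q.1| ^+ 2 + `|lam t - q.2| ^+ 2) -
     ('<| p.1, p.1 |> + '<| p.2, p.2 |>) + ('<| q.1, q.1 |> + '<| q.2, q.2 |>))) by exact: h.
  apply: funext => t; rewrite /k -!inner_normE !innerE.
  rewrite !(innerC _ (x t)) !(innerC _ (lam t)); lra.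
have ev (V : set_system R) r : UltraFilter V -> +oo%R `<=` V ->
   (forall w, '<| x t, w |> @[t --> V] --> '<| r.1, w |>) ->
   (forall w, '<| lam t, w |> @[t --> V] --> '<| r.2, w |>) ->
   '<| r.1, p.1 - q.1 |> + '<| r.2, p.2 - q.2 |> = c.
  move=> UV FV r1 r2.
  apply: (@cvg_unique _ (@Rhausdorff R)
    (fmap (fun t => '<| x t, p.1 - q.1 |> + '<| lam t, p.2 - q.2 |>) V)).
    by apply: cvgD; [exact: r1|exact: r2].
  by move=> B /hc; exact: FV.
have E : '<| p.1 - q.1, p.1 - q.1 |> + '<| p.2 - q.2, p.2 - q.2 |> = 0.
  have := ev U0 p UU0 FU0 px pl; have := ev U q UU FU qx ql.
  by move=> <-; rewrite !(innerDl _ (- _)) !innerNl; lra.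
move: E => /eqP; rewrite paddr_eq0 ?inner_ge0// !inner_eq0 !subr_eq0.
by case: p q {px pl Sp qx ql Sq hlp hlq c hc ev} => [? ?] [? ?] /= /andP[/eqP-> /eqP->].
Qed.

End Opial.
End WeakLimits.

(** * Saddle points *)

Section SaddlePoints.
Variables (R : realType) (X Y : hilbertType R).
Variables (f : X -> R) (A : {linear X -> Y}) (b : Y) (l : R).
Hypothesis f_diff : forall u, differentiable f u.
Hypothesis l_gt0 : 0 < l.
Hypothesis f_lip : l.-lipschitz (gradient f).
Variables (xs : X) (ls : Y).
Hypothesis saddle : saddle_points f A b (xs, ls).

Lemma saddle_feasible : A xs = b.
Proof.
have [h _] := saddle xs (ls + (A xs - b)).
move: h; rewrite /lagrangian /= innerDl addrA gerDl => h.
by apply/eqP; rewrite -subr_eq0 -inner_eq0 eq_le h inner_ge0.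
Qed.

Lemma saddle_minimizes u : f xs <= f u + '<| ls, A u - b |>.
Proof.
have [_] := saddle u ls; rewrite /lagrangian /=.
by rewrite saddle_feasible subrr inner0r addr0.
Qed.

(** By the descent inequality, at xs + s h the Lagrangian at ls exceeds its minimum
    by at most s times the left-hand side plus a multiple of s^2. *)
Lemma saddle_stationary h : '<| gradient f xs, h |> + '<| ls, A h |> = 0.
Proof.
apply: (@linear_coef_eq0 _ _ (l / 2 * `|h| ^+ 2)) => s.
have := saddle_minimizes (xs + s *: h).
have := descent f_diff f_lip xs (xs + s *: h).
rewrite (linearD A) (linearZ_LR A) saddle_feasible [b + _ - b]addrAC subrr add0r.
rewrite [xs + _ - xs]addrAC subrr add0r !innerZr normrZ exprMn real_normK ?num_real//.
lra.
Qed.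

End SaddlePoints.

(** * Energy estimates *)

Section Dynamics.
Variables (R : realType) (X Y : hilbertType R).
Variables (f : X -> R) (A : {linear X -> Y}) (b : Y).
Variables (l t0 alpha theta beta tau d0 : R) (delta ddelta : R -> R).
Variables (x dx ddx : R -> X) (lam dlam ddlam : R -> Y).
Hypothesis f_convex : convex_function (E := X) setT f.
Hypothesis f_diff : forall u, differentiable f u.
Hypothesis A_cont : continuous A.
Hypothesis l_gt0 : 0 < l.
Hypothesis f_lip : l.-lipschitz (gradient f).
Hypothesis t0_gt0 : 0 < t0.
Hypothesis theta_gt0 : 0 < theta.
Hypothesis theta_gt : 1 < theta * (alpha - 1).
Hypothesis tau_lt : 2 * theta + theta * tau < 1.
Hypothesis beta_ge0 : 0 <= beta.
Hypothesis d0_gt0 : 0 < d0.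
Hypothesis delta_ge : forall t : R, t0 < t -> d0 <= delta t.
Hypothesis ddelta_bound : forall t : R, t0 < t -> 0 <= t * ddelta t <= tau * delta t.
Hypothesis delta_derive : forall t : R, t0 < t -> is_derive t 1 delta (ddelta t).
Hypothesis x_derive : forall t : R, t0 < t -> is_derive t 1 x (dx t).
Hypothesis dx_derive : forall t : R, t0 < t -> is_derive t 1 dx (ddx t).
Hypothesis lam_derive : forall t : R, t0 < t -> is_derive t 1 lam (dlam t).
Hypothesis dlam_derive : forall t : R, t0 < t -> is_derive t 1 dlam (ddlam t).
Hypothesis x_eq : forall (t : R) (w : X), t0 < t -> '<| ddx t, w |> + alpha / t * '<| dx t, w |> +
  delta t * ('<| gradient f (x t), w |> + '<| lam t + (theta * t) *: dlam t, A w |> +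
             beta * '<| A (x t) - b, A w |>) = 0.
Hypothesis lam_eq : forall (t : R) (y : Y), t0 < t ->
  '<| ddlam t, y |> + alpha / t * '<| dlam t, y |> =
  delta t * '<| A (x t + (theta * t) *: dx t) - b, y |>.

Lemma near_after (P : R -> Prop) :
  (forall t, t0 < t -> P t) -> \forall t \near +oo, P t.
Proof. by move=> h; apply: filterS (nbhs_pinfty_gt (num_real t0)) => t; exact: h. Qed.

Section AtSaddle.
Variables (xs : X) (ls : Y).
Hypothesis saddle : saddle_points f A b (xs, ls).

(** The difference L(x(t), ls) - L(xs, lam(t)) for the augmented Lagrangian
    L(u, y) = f u + <y, A u - b> + beta / 2 |A u - b|^2; the second term is f xs
    because xs is feasible. *)
Definition gap (t : R) : R := f (x t) - f xs + '<| ls, A (x t) - b |> +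
  beta / 2 * '<| A (x t) - b, A (x t) - b |>.
Definition dgap (t : R) : R := '<| gradient f (x t), dx t |> + '<| ls, A (dx t) |> +
  beta * '<| A (x t) - b, A (dx t) |>.
Definition kinetic (t : R) : R := 2^-1 * ('<| dx t, dx t |> + '<| dlam t, dlam t |>).
Definition dkinetic (t : R) : R := '<| dx t, ddx t |> + '<| dlam t, ddlam t |>.
Definition anchor (t : R) : R := 2^-1 * ('<| x t - xs, x t - xs |> + '<| lam t - ls, lam t - ls |>).
Definition danchor (t : R) : R := '<| x t - xs, dx t |> + '<| lam t - ls, dlam t |>.
Definition ddanchor (t : R) : R :=
  2 * kinetic t + '<| x t - xs, ddx t |> + '<| lam t - ls, ddlam t |>.
Definition potential (t : R) : R := theta * (t * t * (delta t * gap t + kinetic t)).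
Definition dpotential (t : R) : R := theta * ((1 * t + t * 1) * (delta t * gap t + kinetic t) +
  t * t * (ddelta t * gap t + delta t * dgap t + dkinetic t)).
(** 1 / theta times the Lyapunov function of energy_split, in the form
    t W' + (alpha - 1) W = energy - potential with W = anchor. *)
Definition energy (t : R) : R := potential t + (alpha - 1) * anchor t + t * danchor t.
Definition denergy (t : R) : R := dpotential t + (alpha - 1) * danchor t +
  (1 * danchor t + t * ddanchor t).

Let feas := saddle_feasible saddle.

Lemma is_derive_gap (t : R) : t0 < t -> is_derive t 1 gap (dgap t).
Proof.
move=> ht; have hx := x_derive ht.
have hA : is_derive t 1 (fun s => A (x s) - b) (A (dx t)).
  by rewrite -[A (dx t)]addr0 -oppr0; apply: is_deriveB; exact: is_derive_linear.
have h1 := is_derive_add (is_derive_comp_gradient hx (f_diff _)) (is_derive_cst (- f xs) t 1).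
have h2 := is_derive_inner (is_derive_cst ls t 1) hA.
have h3 := is_derive_scale (is_derive_inner hA hA) (beta / 2).
apply: (@is_derive_eq _ _ _ gap _ _ _ _ (is_derive_add (is_derive_add h1 h2) h3)).
rewrite /dgap /= addr0 inner0l add0r (innerC (A (dx t))).
by field.
Qed.

Lemma is_derive_kinetic (t : R) : t0 < t -> is_derive t 1 kinetic (dkinetic t).
Proof.
move=> ht.
have := is_derive_add (is_derive_half_sqr (dx_derive ht)) (is_derive_half_sqr (dlam_derive ht)).
suff -> : (fun s => 2^-1 * '<| dx s, dx s |> + 2^-1 * '<| dlam s, dlam s |>) = kinetic by [].
by apply: funext => s; rewrite /kinetic mulrDr.
Qed.

Lemma is_derive_anchor (t : R) : t0 < t -> is_derive t 1 anchor (danchor t).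
Proof.
move=> ht.
have := is_derive_add (is_derive_half_sqr (is_derive_subc xs (x_derive ht)))
  (is_derive_half_sqr (is_derive_subc ls (lam_derive ht))).
set g := (fun s : R => _ + _); suff -> : g = anchor by [].
by apply: funext => s; rewrite /g /anchor mulrDr.
Qed.

Lemma is_derive_danchor (t : R) : t0 < t -> is_derive t 1 danchor (ddanchor t).
Proof.
move=> ht.
apply: (@is_derive_eq _ _ _ danchor _ _ _ _ (is_derive_add
    (is_derive_inner (is_derive_subc xs (x_derive ht)) (dx_derive ht))
    (is_derive_inner (is_derive_subc ls (lam_derive ht)) (dlam_derive ht)))).
by rewrite /ddanchor /kinetic; field.
Qed.

Lemma is_derive_energy (t : R) : t0 < t -> is_derive t 1 energy (denergy t).
Proof.
move=> ht; have dv := is_derive_var t.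
have hp : is_derive t 1 potential (dpotential t).
  exact: is_derive_scale (is_derive_mul (is_derive_mul dv dv) (is_derive_add
    (is_derive_mul (delta_derive ht) (is_derive_gap ht)) (is_derive_kinetic ht))) _.
exact: is_derive_add (is_derive_add hp (is_derive_scale (is_derive_anchor ht) _))
  (is_derive_mul dv (is_derive_danchor ht)).
Qed.

Lemma gap_ge0 (t : R) : 0 <= gap t.
Proof.
have := saddle_minimizes saddle (x t).
have : 0 <= beta / 2 * '<| A (x t) - b, A (x t) - b |>.
  by rewrite mulr_ge0 ?inner_ge0// divr_ge0.
rewrite /gap; lra.
Qed.

Lemma kinetic_ge0 (t : R) : 0 <= kinetic t.
Proof. by rewrite mulr_ge0 ?invr_ge0// addr_ge0 ?inner_ge0. Qed.

Lemma potential_ge0 (t : R) : t0 < t -> 0 <= potential t.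
Proof.
move=> ht; have tp : 0 <= t by exact/ltW/(lt_trans t0_gt0).
have dl0 : 0 <= delta t := le_trans (ltW d0_gt0) (delta_ge ht).
by rewrite !mulr_ge0 ?(ltW theta_gt0)// addr_ge0 ?kinetic_ge0// mulr_ge0// gap_ge0.
Qed.

Lemma anchor_ge0 (t : R) : 0 <= anchor t.
Proof. by rewrite mulr_ge0 ?invr_ge0// addr_ge0 ?inner_ge0. Qed.

(** The factors 2 (theta (alpha - 1) - 1) and 1 - 2 theta - theta tau are the
    dissipation rates of t * kinetic and of t * delta * gap; potential carries an
    extra factor theta. *)
Definition rate := Num.min (2 * (theta * (alpha - 1) - 1)) (1 - 2 * theta - theta * tau) / theta.

Lemma rate_gt0 : 0 < rate.
Proof.
have h1 : 0 < 2 * (theta * (alpha - 1) - 1) by have h := theta_gt; lra.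
have h2 : 0 < 1 - 2 * theta - theta * tau by have h := tau_lt; lra.
by rewrite divr_gt0// lt_min h1 h2.
Qed.

(** The equations are tested against x - xs, x', lam - ls and lam'.  The products
    <lam - ls, A x'> and <lam', A x - b> then cancel, because both equations
    extrapolate by the same theta t; what is left is controlled by the tangent
    inequality at x(t) and the growth of delta. *)
Lemma energy_dissipation (t : R) : t0 < t -> t * denergy t <= - (rate * potential t).
Proof.
move=> ht; have tp : 0 < t by exact: lt_trans ht.
set g := A (x t) - b.
have Au : A (x t - xs) = g by rewrite (linearB A) feas.
have e1 := x_eq (x t - xs) ht; have e2 := x_eq (dx t) ht.
have e3 := lam_eq (lam t - ls) ht; have e4 := lam_eq (dlam t) ht.
rewrite Au -/g in e1; rewrite -/g in e2.
have E : A (x t + (theta * t) *: dx t) - b = g + (theta * t) *: A (dx t).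
  by rewrite (linearD A) (linearZ_LR A) addrAC.
rewrite {}E in e3 e4.
have tangent := convex_above_tangent f_diff (x t) xs f_convex.
rewrite -[xs - x t]opprB innerNr in tangent.
have F0 := gap_ge0 t; have K0 := kinetic_ge0 t.
have Fdef : gap t = f (x t) - f xs + '<| ls, g |> + beta / 2 * '<| g, g |> by [].
have g0 : 0 <= beta / 2 * '<| g, g |> by rewrite mulr_ge0 ?inner_ge0// divr_ge0.
have key : denergy t = - (2 * (theta * (alpha - 1) - 1)) * (t * kinetic t)
   + t * (theta * (2 * delta t + t * ddelta t)) * gap t
   - t * delta t * ('<| gradient f (x t), x t - xs |> + '<| ls, g |> + beta * '<| g, g |>).
  have L : lam t = (lam t - ls) + ls by rewrite subrK.
  rewrite {1}L in e1; rewrite {1}L in e2.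
  move: e1 e2 e3 e4.
  rewrite /denergy /dpotential /ddanchor /dgap /dkinetic /danchor /kinetic -/g.
  rewrite !(innerDl (lam t - ls + ls)) !(innerDl (lam t - ls) ls) !(innerDl g) !innerZl.
  rewrite !(innerC (dx t) (x t - xs)) !(innerC (dlam t) (lam t - ls)).
  rewrite !(innerC _ (ddx t)) !(innerC _ (ddlam t)).
  rewrite !(innerC g (lam t - ls)) !(innerC g (dlam t)).
  rewrite !(innerC (A (dx t)) (lam t - ls)) !(innerC (A (dx t)) (dlam t)).
  move: '<| ddx t, x t - xs |> '<| ddx t, dx t |> '<| ddlam t, lam t - ls |>
    '<| ddlam t, dlam t |> => a1 a2 a3 a4 e1 e2 e3 e4.
  have {e1}-> : a1 = - (alpha / t * '<| x t - xs, dx t |>) - delta t * (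
    '<| gradient f (x t), x t - xs |> + ('<| lam t - ls, g |> + '<| ls, g |> +
     theta * t * '<| dlam t, g |>) + beta * '<| g, g |>) by lra.
  have {e2}-> : a2 = - (alpha / t * '<| dx t, dx t |>) - delta t * (
    '<| gradient f (x t), dx t |> + ('<| lam t - ls, A (dx t) |> + '<| ls, A (dx t) |> +
     theta * t * '<| dlam t, A (dx t) |>) + beta * '<| g, A (dx t) |>) by lra.
  have {e3}-> : a3 = - (alpha / t * '<| lam t - ls, dlam t |>) + delta t *
    ('<| lam t - ls, g |> + theta * t * '<| lam t - ls, A (dx t) |>) by lra.
  have {e4}-> : a4 = - (alpha / t * '<| dlam t, dlam t |>) + delta t *
    ('<| dlam t, g |> + theta * t * '<| dlam t, A (dx t) |>) by lra.
  by field; rewrite gt_eqF.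
have [dd0 dd1] := andP (ddelta_bound ht).
have dl0 : 0 < delta t := lt_le_trans d0_gt0 (delta_ge ht).
have td : 0 <= t * delta t by rewrite mulr_ge0// ltW.
set Q := '<| gradient f (x t), x t - xs |> + '<| ls, g |> + beta * '<| g, g |> in key.
have QF : gap t <= Q by rewrite Fdef /Q; move: tangent g0; lra.
set k1 := 2 * (theta * (alpha - 1) - 1).
set k2 := 1 - 2 * theta - theta * tau.
have m1 : theta * rate <= k1.
  by rewrite /rate mulrC divfK ?gt_eqF// ge_min lexx.
have m2 : theta * rate <= k2.
  by rewrite /rate mulrC divfK ?gt_eqF// ge_min lexx orbT.
have h1 := ler_wpM2l td QF.
have h2 : theta * (t * ddelta t) <= theta * (tau * delta t) by rewrite ler_pM2l.
have h3 : theta * (t * ddelta t) * gap t <= theta * (tau * delta t) * gap t.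
  by rewrite ler_wpM2r.
have h4 : denergy t <= - k1 * (t * kinetic t) - k2 * (t * (delta t * gap t)).
  rewrite key /k1 /k2; have := ler_wpM2l (ltW tp) h3; lra.
have h5 : theta * rate * (t * kinetic t) <= k1 * (t * kinetic t).
  by rewrite ler_wpM2r// mulr_ge0// ltW.
have h6 : theta * rate * (t * (delta t * gap t)) <= k2 * (t * (delta t * gap t)).
  by rewrite ler_wpM2r// mulr_ge0 ?(ltW tp)// mulr_ge0 ?(ltW dl0).
have h7 : denergy t <= - (theta * rate * (t * (delta t * gap t + kinetic t))) by lra.
have := ler_wpM2l (ltW tp) h7; rewrite /potential; lra.
Qed.


Lemma energy_nonincreasing (s t : R) : t0 < s -> s <= t -> energy t <= energy s.
Proof.
move=> hs st; apply: (@le_of_derive _ _ _ energy denergy) => // r /andP[sr _].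
  by apply: is_derive_energy; exact: lt_le_trans sr.
have hr : t0 < r by exact: lt_le_trans sr.
have r0 : 0 < r by exact: lt_trans hr.
rewrite -(pmulr_rle0 _ r0); apply: le_trans (energy_dissipation hr) _.
by rewrite oppr_le0 mulr_ge0 ?(ltW rate_gt0)//; exact: potential_ge0.
Qed.

(** Completing the square around z - zs + theta t z', which exhibits the energy as
    a sum of nonnegative terms. *)
Lemma energy_split (t : R) : theta * energy t =
  theta ^+ 2 * (t * t * (delta t * gap t)) +
  2^-1 * ('<| x t - xs + (theta * t) *: dx t, x t - xs + (theta * t) *: dx t |> +
    '<| lam t - ls + (theta * t) *: dlam t, lam t - ls + (theta * t) *: dlam t |>) +
  (theta * (alpha - 1) - 1) * anchor t.
Proof.
rewrite /energy /potential /kinetic /anchor /danchor.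
rewrite !(innerDl (x t - xs)) !(innerDl (lam t - ls)) !(innerDr (x t - xs))
  !(innerDr (lam t - ls)) !innerZl !innerZr.
rewrite !(innerC (dx t) (x t - xs)) !(innerC (dlam t) (lam t - ls)).
by field.
Qed.

(** Each summand in energy_split stays below the initial energy, and theta t z' is
    the difference of the bounded vectors z - zs + theta t z' and z - zs. *)
Lemma energy_bounds : exists C : R, forall t, t0 + 1 <= t ->
  [/\ anchor t <= C, t * t * (delta t * gap t) <= C & t * t * kinetic t <= C].
Proof.
pose E := theta * energy (t0 + 1).
have k1 : 0 < theta * (alpha - 1) - 1 by rewrite subr_gt0.
have th2 : 0 < theta ^+ 2 by rewrite exprn_gt0.
set k := theta * (alpha - 1) - 1 in k1.
exists (E / k + E / theta ^+ 2 + (2 * E + 2 * (E / k)) / theta ^+ 2) => t ht.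
have ht0 : t0 < t by apply: lt_le_trans ht; rewrite ltrDl.
have tp : 0 < t by exact: lt_trans ht0.
have : theta * energy t <= E.
  by rewrite ler_pM2l//; apply: energy_nonincreasing; rewrite ?ltrDl.
rewrite energy_split -/k.
set p1 := '<| x t - xs + _, _ |>; set p2 := '<| lam t - ls + _, _ |>.
have dl0 : 0 < delta t := lt_le_trans d0_gt0 (delta_ge ht0).
have p10 : 0 <= p1 by exact: inner_ge0.
have p20 : 0 <= p2 by exact: inner_ge0.
have W0 := anchor_ge0 t.
have F0 : 0 <= t * t * (delta t * gap t).
  apply: mulr_ge0; first by apply: mulr_ge0; exact: ltW.
  by apply: mulr_ge0; [exact: ltW|exact: gap_ge0].
have K0 : 0 <= t * t * kinetic t.
  by apply: mulr_ge0; [apply: mulr_ge0; exact: ltW|exact: kinetic_ge0].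
have kW0 : 0 <= k * anchor t by rewrite mulr_ge0// ltW.
have tF0 : 0 <= theta ^+ 2 * (t * t * (delta t * gap t)) by rewrite mulr_ge0// ltW.
move=> h.
have hW : anchor t <= E / k by rewrite ler_pdivlMr// mulrC; lra.
have hF : t * t * (delta t * gap t) <= E / theta ^+ 2.
  by rewrite ler_pdivlMr// mulrC; lra.
have hK : t * t * kinetic t <= (2 * E + 2 * (E / k)) / theta ^+ 2.
  rewrite ler_pdivlMr//.
  (* |v - w|^2 <= 2 |v|^2 + 2 |w|^2 for v = w + theta t z' and w = z - zs, in the
     form |v + w|^2 >= 0 *)
  have q1 := inner_ge0 (2 *: (x t - xs) + (theta * t) *: dx t).
  have q2 := inner_ge0 (2 *: (lam t - ls) + (theta * t) *: dlam t).
  suff : t * t * kinetic t * theta ^+ 2 <= (p1 + p2) + 2 * anchor t by lra.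
  move: q1 q2; rewrite /p1 /p2 /kinetic /anchor.
  rewrite !(innerDl (x t - xs)) !(innerDl (lam t - ls)) !(innerDr (x t - xs))
    !(innerDr (lam t - ls)) !(innerDl (2 *: _)) !(innerDr (2 *: _)) !innerZl !innerZr.
  rewrite !(innerC (dx t) (x t - xs)) !(innerC (dlam t) (lam t - ls)).
  lra.
have E0 : 0 <= E by lra.
have e1 : 0 <= E / k by rewrite divr_ge0// ltW.
have e2 : 0 <= E / theta ^+ 2 by rewrite divr_ge0// ltW.
have e3 : 0 <= (2 * E + 2 * (E / k)) / theta ^+ 2.
  by rewrite divr_ge0 ?(ltW th2)//; lra.
by split; lra.
Qed.

Lemma anchor_cvg : exists m : R, anchor t @[t --> +oo] --> m.
Proof.
have [m hm] : exists m : R, energy t @[t --> +oo] --> m.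
  apply: (@nonincreasing_is_cvg R energy 0 (t0 + 1)) => [s t hs|t ht].
    by apply: energy_nonincreasing; apply: lt_le_trans hs; rewrite ltrDl.
  have ht0 : t0 < t by apply: lt_le_trans ht; rewrite ltrDl.
  rewrite -(pmulr_rge0 _ theta_gt0) energy_split.
  have dl0 : 0 <= delta t := le_trans (ltW d0_gt0) (delta_ge ht0).
  have tp : 0 <= t by exact/ltW/(lt_trans t0_gt0).
  have k1 : 0 <= theta * (alpha - 1) - 1 by rewrite subr_ge0 ltW.
  apply: addr_ge0; last by apply: mulr_ge0 => //; exact: anchor_ge0.
  apply: addr_ge0; last by apply: mulr_ge0; rewrite ?invr_ge0// addr_ge0 ?inner_ge0.
  apply: mulr_ge0; first exact/ltW/exprn_gt0.
  apply: mulr_ge0; first exact: mulr_ge0.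
  by apply: mulr_ge0 => //; exact: gap_ge0.
exists (m / (alpha - 1)).
apply: (@dissipation_cvg R (alpha - 1) rate anchor danchor energy denergy potential m).
- by rewrite -(pmulr_rgt0 _ theta_gt0); exact: lt_trans theta_gt.
- exact: rate_gt0.
- exact/near_after/is_derive_anchor.
- exact/near_after/is_derive_energy.
- by apply: near_after => t _; rewrite /energy; ring.
- exact/near_after/potential_ge0.
- exact/near_after/energy_dissipation.
- exact: hm.
Qed.

End AtSaddle.

(** * Weak convergence of the trajectory *)

Section Limits.
Variables (xs : X) (ls : Y).
Hypothesis saddle : saddle_points f A b (xs, ls).

Lemma trajectory_bounded : exists M : R, \forall t \near +oo,
  [/\ `|x t| <= M, `|lam t| <= M, t * `|dx t| <= M & t * `|dlam t| <= M].
Proof.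
have [C hC] := energy_bounds saddle.
exists (1 + 2 * C + `|xs| + `|ls|).
apply: filterS (nbhs_pinfty_ge (num_real (t0 + 1))) => t /hC[hW _ hK].
have xs0 := normr_ge0 xs; have ls0 := normr_ge0 ls.
have sq (r : R) : r <= 1 + r ^+ 2 by have := sqr_ge0 (r - 2^-1); nra.
move: hW hK; rewrite /anchor /kinetic !inner_normE => hW hK.
have sx := sqr_ge0 `|x t - xs|; have sl := sqr_ge0 `|lam t - ls|.
have sdx := sqr_ge0 (t * `|dx t|); have sdl := sqr_ge0 (t * `|dlam t|).
rewrite !exprMn in sdx sdl.
split.
- have := sq `|x t - xs|; have := ler_normD (x t - xs) xs; rewrite subrK; lra.
- have := sq `|lam t - ls|; have := ler_normD (lam t - ls) ls; rewrite subrK; lra.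
- have := sq (t * `|dx t|); rewrite exprMn; lra.
- have := sq (t * `|dlam t|); rewrite exprMn; lra.
Qed.

Lemma gap_cvg0 : gap xs ls t @[t --> +oo] --> (0 : R).
Proof.
have [C hC] := energy_bounds saddle.
apply: (@cvg0_of_le_inv _ _ (C / d0)).
apply: filterS2 (nbhs_pinfty_ge (num_real (t0 + 1)))
  (nbhs_pinfty_ge (num_real 1)) => t ht t1.
have [_ h _] := hC t ht.
have ht0 : t0 < t by apply: lt_le_trans ht; rewrite ltrDl.
have tp : 0 < t by exact: lt_le_trans t1.
have F0 := gap_ge0 saddle t.
rewrite (ger0_norm F0) ler_pdivlMr// ler_pdivlMr//; apply: le_trans h.
have -> : gap xs ls t * t * d0 = (1 * t) * (d0 * gap xs ls t) by ring.
by rewrite ler_pM ?mulr_ge0 ?(ltW d0_gt0) ?(ltW tp)// ler_wpM2r// ?(ltW tp)// delta_ge.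
Qed.

(** Cocoercivity bounds |gradient f (x(t)) - gradient f xs|^2 by 2 l times the
    gap. *)
Lemma gradient_cvg w :
  '<| gradient f (x t) - gradient f xs, w |> @[t --> +oo] --> (0 : R).
Proof.
apply/cvgr0Pnorm_le => eps e0.
pose k := 2 * l * (`|w| ^+ 2 + 1).
have k0 : 0 < k by rewrite mulr_gt0 ?mulr_gt0// ltr_wpDl ?sqr_ge0.
have /cvgr0Pnorm_le/(_ (eps ^+ 2 / k)) := gap_cvg0.
move=> /(_ (ltac:(by rewrite divr_gt0 ?exprn_gt0))); apply: filterS => t h.
have {}h : gap xs ls t * k <= eps ^+ 2.
  by rewrite -ler_pdivlMr//; apply: le_trans h; exact: ler_norm.
have gg := gradient_gap f_diff l_gt0 f_lip xs (x t) f_convex.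
have stat := saddle_stationary f_diff f_lip saddle (x t - xs).
rewrite (linearB A) (saddle_feasible saddle) in stat.
have g0 : 0 <= beta / 2 * '<| A (x t) - b, A (x t) - b |>.
  by rewrite mulr_ge0 ?inner_ge0// divr_ge0.
have {}gg : (2 * l)^-1 * `|gradient f (x t) - gradient f xs| ^+ 2 <= gap xs ls t.
  by rewrite /gap; lra.
move: gg; rewrite ler_pdivrMl ?mulr_gt0// => gg.
rewrite -(@ler_pXn2r _ 2) ?nnegrE ?(ltW e0)//.
have := cauchy_schwarz (gradient f (x t) - gradient f xs) w => cs.
apply: le_trans (_ : (`|gradient f (x t) - gradient f xs| * `|w|) ^+ 2 <= _).
  by rewrite ler_pXn2r ?nnegrE ?mulr_ge0.
rewrite exprMn; apply: le_trans h.
have F0 := gap_ge0 saddle t.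
apply: le_trans (ler_wpM2r (sqr_ge0 _) gg) _.
rewrite /k; have : 0 <= 2 * l * gap xs ls t by rewrite !mulr_ge0// ltW.
lra.
Qed.

Lemma inner_bound (H : hilbertType R) (u : R -> H) M w :
  (\forall t \near +oo, `|u t| <= M) ->
  \forall t \near +oo, `|'<| u t, w |>| <= M * `|w|.
Proof.
apply: filterS => t h; apply: le_trans (cauchy_schwarz _ _) _.
by rewrite ler_wpM2r.
Qed.

(** The lam-equation tested against y, with A x - b as the forcing term. *)
Lemma feasibility_cvg y : '<| A (x t) - b, y |> @[t --> +oo] --> (0 : R).
Proof.
have [M hM] := trajectory_bounded.
apply: (@forced_decay _ (fun t => '<| lam t, y |>) (fun t => '<| dlam t, y |>)
  (fun t => '<| ddlam t, y |>) _ (fun t => '<| A (dx t), y |>) (fun=> 0) delta ddelta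
  alpha theta tau d0 (M * `|y|)) => //.
- apply: near_after => t ht; apply: is_derive_eq
    (is_derive_inner (lam_derive ht) (is_derive_cst y t 1)) _.
  by rewrite inner0r addr0.
- apply: near_after => t ht; apply: is_derive_eq
    (is_derive_inner (dlam_derive ht) (is_derive_cst y t 1)) _.
  by rewrite inner0r addr0.
- apply: near_after => t ht; apply: is_derive_eq
    (is_derive_inner (is_derive_subc b (is_derive_linear A_cont (x_derive ht)))
      (is_derive_cst y t 1)) _.
  by rewrite inner0r addr0.
- exact: near_after.
- exact: near_after.
- exact: near_after.
- by apply: inner_bound; apply: filterS hM => t [].
- have : \forall t \near +oo, `|t *: dlam t| <= M.
    apply: filterS2 hM (nbhs_pinfty_ge (num_real 0)) => t [_ _ _ h] tp.
    by rewrite normrZ ger0_norm.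
  by move=> /(inner_bound y); apply: filterS => t; rewrite innerZl.
- apply: near_after => t ht; rewrite mulr0 addr0 lam_eq//.
  by rewrite (linearD A) (linearZ_LR A) addrAC innerDl innerZl.
- exact: cvg_cst.
Qed.

(** The x-equation tested against w.  Stationarity of (xs, ls) turns
    gradient f (x(t)) + A^* lam into A^* (lam - ls) plus a term that tends to 0. *)
Lemma multiplier_cvg w : '<| lam t - ls, A w |> @[t --> +oo] --> (0 : R).
Proof.
have [M hM] := trajectory_bounded.
pose e t := '<| gradient f (x t) - gradient f xs, w |> + beta * '<| A (x t) - b, A w |>.
apply: (@forced_decay _ (fun t => - '<| x t, w |>) (fun t => - '<| dx t, w |>)
  (fun t => - '<| ddx t, w |>) _ (fun t => '<| dlam t, A w |>) e delta ddelta
  alpha theta tau d0 (M * `|w|)) => //.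
- apply: near_after => t ht; apply: is_derive_opp; apply: is_derive_eq
    (is_derive_inner (x_derive ht) (is_derive_cst w t 1)) _.
  by rewrite inner0r addr0.
- apply: near_after => t ht; apply: is_derive_opp; apply: is_derive_eq
    (is_derive_inner (dx_derive ht) (is_derive_cst w t 1)) _.
  by rewrite inner0r addr0.
- apply: near_after => t ht; apply: is_derive_eq
    (is_derive_inner (is_derive_subc ls (lam_derive ht)) (is_derive_cst (A w) t 1)) _.
  by rewrite inner0r addr0.
- exact: near_after.
- exact: near_after.
- exact: near_after.
- have : \forall t \near +oo, `|x t| <= M by apply: filterS hM => t [].
  by move=> /(inner_bound w); apply: filterS => t; rewrite normrN.
- have : \forall t \near +oo, `|t *: dx t| <= M.
    apply: filterS2 hM (nbhs_pinfty_ge (num_real 0)) => t [_ _ h _] tp.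
    by rewrite normrZ ger0_norm.
  by move=> /(inner_bound w); apply: filterS => t; rewrite innerZl mulrN normrN.
- apply: near_after => t ht.
  have /eqP := saddle_stationary f_diff f_lip saddle w.
  rewrite addr_eq0 => stat; have := x_eq w ht; move: stat; rewrite /e.
  move: (gradient f (x t)) (gradient f xs) => p q /eqP stat.
  rewrite !(innerDl (lam t)) (innerDl p) !innerNl stat !innerZl.
  move: '<| ddx t, w |> '<| dx t, w |> '<| p, w |> '<| lam t, A w |>
    '<| ls, A w |> '<| dlam t, A w |> '<| A (x t) - b, A w |> => a1 a2 a3 a4 a5 a6 a7.
  move=> h; apply/eqP; rewrite -subr_eq0 -oppr_eq0; apply/eqP; rewrite -[RHS]h.
  by ring.
- rewrite -[X in _ --> X]addr0 -[X in _ --> _ + X](mulr0 beta).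
  apply: cvgD; first exact: gradient_cvg.
  by apply: cvgM; [exact: cvg_cst|exact: feasibility_cvg].
Qed.

(** Feasibility and A^* (p.2 - ls) = 0 pass to weak limits by linearity.  For the
    minimality of p.1, the tangent to f at p.1 is a weakly continuous lower bound
    and the gap tends to 0, so f p.1 <= f xs. *)
Lemma weak_cluster_saddle (U : set_system R) (p : X * Y) :
  UltraFilter U -> +oo%R `<=` U ->
  (forall w, '<| x t, w |> @[t --> U] --> '<| p.1, w |>) ->
  (forall w, '<| lam t, w |> @[t --> U] --> '<| p.2, w |>) -> saddle_points f A b p.
Proof.
move=> UU FU px pl.
have along (g : R -> R) (n : R) : g t @[t --> +oo] --> n -> g t @[t --> U] --> n.
  by move=> gn B /gn; exact: FU.
have uniq (g : R -> R) (m n : R) : g t @[t --> U] --> m -> g t @[t --> +oo] --> n -> m = n.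
  move=> gm gn; apply: (@cvg_unique _ (@Rhausdorff R) (fmap g U)) => //.
  exact: along.
have Ap : A p.1 = b.
  apply: inner_eq => y; apply/eqP; rewrite -subr_eq0; apply/eqP.
  apply: (uniq (fun t => '<| A (x t) - b, y |>)); last exact: feasibility_cvg.
  have -> : (fun t => '<| A (x t) - b, y |>) =
      (fun t => '<| x t, adjoint A y |> - '<| b, y |>).
    by apply: funext => t; rewrite innerDl innerNl adjointE.
  by rewrite adjointE//; apply: cvgB; [exact: px|exact: cvg_cst].
have pA w : '<| p.2 - ls, A w |> = 0.
  apply: (uniq (fun t => '<| lam t - ls, A w |>)); last exact: multiplier_cvg.
  have -> : (fun t => '<| lam t - ls, A w |>) =
      (fun t => '<| lam t, A w |> - '<| ls, A w |>).
    by apply: funext => t; rewrite innerDl innerNl.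
  by rewrite innerDl innerNl; apply: cvgB; [exact: pl|exact: cvg_cst].
have fp : f p.1 <= f xs.
  have c1 : (f p.1 - f xs + ('<| x t, gradient f p.1 |> - '<| p.1, gradient f p.1 |>)
      + '<| A (x t) - b, ls |> - gap xs ls t) @[t --> U] -->
      (f p.1 - f xs + ('<| p.1, gradient f p.1 |> - '<| p.1, gradient f p.1 |>) + 0 - 0).
    apply: cvgB; last by apply: along; exact: gap_cvg0.
    apply: cvgD; last by apply: along; exact: feasibility_cvg.
    apply: cvgD; first exact: cvg_cst.
    by apply: cvgB; [exact: px|exact: cvg_cst].
  rewrite -subr_le0.
  have -> : f p.1 - f xs = f p.1 - f xs +
    ('<| p.1, gradient f p.1 |> - '<| p.1, gradient f p.1 |>) + 0 - 0 by ring.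
  apply: (closed_cvg (fun r : R => r <= 0) _ _ _ c1); first exact: closed_le.
  apply: nearW => t.
  have := convex_above_tangent f_diff p.1 (x t) f_convex.
  have g0 : 0 <= beta / 2 * '<| A (x t) - b, A (x t) - b |>.
    by rewrite mulr_ge0 ?inner_ge0// divr_ge0.
  rewrite innerC innerDl innerNl /gap (innerC ls); lra.
move=> u y; rewrite /lagrangian Ap subrr !inner0r addr0; split=> //.
apply: le_trans fp _; apply: le_trans (saddle_minimizes saddle u) _.
have := pA (u - p.1); rewrite (linearB A) Ap innerDl innerNl; lra.
Qed.

End Limits.

Theorem trajectory_weak_cvg z0 : saddle_points f A b z0 ->
  exists2 z, saddle_points f A b z & weakly_cvg_prod (fun t => (x t, lam t)) z.
Proof.
move: z0 => [xs ls] saddle.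
have [M hM] := trajectory_bounded saddle.
apply: (@opial _ _ _ _ _ _ M).
- by apply: filterS hM => t [].
- by apply: filterS hM => t [].
- move=> [qx ql] /anchor_cvg[m hm]; exists (2 * m).
  have -> : (fun t => `|x t - qx| ^+ 2 + `|lam t - ql| ^+ 2) = (fun t => 2 * anchor qx ql t).
    by apply: funext => t; rewrite /anchor !inner_normE; field.
  by apply: cvgM; [exact: cvg_cst|exact: hm].
- exact: (weak_cluster_saddle saddle).
Qed.

End Dynamics.

Theorem theorem4p9 (R : realType) (X Y : hilbertType R)
    (f : X -> R) (A : {linear X -> Y}) (b : Y)
    (t0 alpha theta beta l : R) (delta : R -> R)
    (x0 : X) (lam0 : Y) (dx0 : X) (dlam0 : Y)
    (x : R -> X) (lam : R -> Y) (xs : X) (lams : Y)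
    (f_convex : convex_function (E := X) setT f)
    (f_diff : forall u : X, differentiable f u)
    (f_C1 : continuous (gradient f))
    (A_cont : continuous A)
    (t0_gt0 : 0 < t0)
    (l_gt0 : 0 < l)
    (f_lip : l.-lipschitz (gradient f))
    (delta_gt0 : forall t, t0 <= t -> 0 < delta t)
    (delta_C1 : C1_on `[t0, +oo[ delta)
    (delta_nd : {in `[t0, +oo[ &, {homo delta : s t / s <= t}})
    (alpha_gt3 : 3 < alpha)
    (beta_ge0 : 0 <= beta)
    (theta_lt : theta < 2^-1)
    (theta_gt : (alpha - 1)^-1 < theta)
    (delta_sup :
       (ereal_sup [set (t * derive_in `[t0, +oo[ delta t / delta t)%:E
                  | t in `[t0, +oo[] < ((1 - 2 * theta) / theta)%:E)%E)
    (sol : DS_solution f A b t0 alpha theta beta delta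
             x0 lam0 dx0 dlam0 x lam)
    (saddle : saddle_points f A b (xs, lams)) :
  exists2 z : X * Y, saddle_points f A b z &
    weakly_cvg_prod (fun t => (x t, lam t)) z.
Proof.
have theta_gt0 : 0 < theta by apply: lt_trans theta_gt; rewrite invr_gt0; lra.
have alpha1 : 0 < alpha - 1 by lra.
have tp t : t0 < t -> 0 < t by exact: lt_trans.
have inD t : t0 <= t -> `[t0, +oo[%classic t by move=> ht; rewrite /= in_itv /= ht.
have nbD t : t0 < t -> nbhs t (`[t0, +oo[%classic : set R).
  move=> ht; apply: filterS (_ : nbhs t (`]t0, +oo[%classic : set R)).
    by move=> s; rewrite /= !in_itv /= => /andP[/ltW ->].
  by apply: open_nbhs_nbhs; split; [exact: interval_open|rewrite /= in_itv /= ht].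
pose D : set R := `[t0, +oo[%classic.
have [tau htau tau_lt] : exists2 tau : R,
    (forall t, t0 <= t -> t * derive_in D delta t <= tau * delta t) &
    tau < (1 - 2 * theta) / theta.
  move: delta_sup; set S := ereal_sup _ => hS.
  have ub t : t0 <= t -> ((t * derive_in D delta t / delta t)%:E <= S)%E.
    by move=> ht; apply: ereal_sup_ubound; exists t => //; exact: inD.
  have [s Ss] : exists s, S = s%:E.
    case: S hS ub => [s| |] // hS ub; first by exists s.
    by have := ub t0 (lexx t0).
  exists s; last by move: hS; rewrite Ss lte_fin.
  by move=> t ht; have := ub t ht; rewrite Ss lee_fin ler_pdivrMr// delta_gt0.
case: sol => [[x_der [dx_der _]] [lam_der [dlam_der _]] eqx eql _].
have hdelta t : t0 < t -> is_derive t 1 delta (derive_in D delta t).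
  by move=> ht; apply: derive_in_is_derive; [exact: nbD|case: delta_C1 => h _; exact/h/inD/ltW].
apply: (trajectory_weak_cvg (alpha := alpha) (tau := tau) (ddelta := derive_in D delta)
  (dx := derive_in D x) (ddx := derive_in D (derive_in D x))
  (dlam := derive_in D lam) (ddlam := derive_in D (derive_in D lam))
  f_convex f_diff A_cont l_gt0 f_lip t0_gt0 theta_gt0 _ _ beta_ge0
  (delta_gt0 t0 (lexx t0)) _ _ hdelta _ _ _ _ _ _ saddle).
- by rewrite -ltr_pdivrMr// mul1r.
- by move: tau_lt; rewrite ltr_pdivlMr// mulrC; lra.
- by move=> t ht; apply: delta_nd; [rewrite in_itv /= lexx|rewrite in_itv /= ltW|exact: ltW].
- move=> t ht; apply/andP; split; last exact/htau/ltW.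
  apply: mulr_ge0; first exact/ltW/tp.
  exact: derive_ge0_of_homo ht delta_nd (hdelta t ht).
- by move=> t ht; apply: derive_in_is_derive; [exact: nbD|exact/x_der/inD/ltW].
- by move=> t ht; apply: derive_in_is_derive; [exact: nbD|exact/dx_der/inD/ltW].
- by move=> t ht; apply: derive_in_is_derive; [exact: nbD|exact/lam_der/inD/ltW].
- by move=> t ht; apply: derive_in_is_derive; [exact: nbD|exact/dlam_der/inD/ltW].
- move=> t w ht; have := eqx t (ltW ht).
  move=> /(congr1 (fun v => '<| v, w |>)); rewrite inner0l !innerDl !innerZl => <-.
  rewrite !(innerC (adjoint A _) w) -!adjointE// !(innerC (A w)) !innerDl !innerZl.
  by ring.
- move=> t y ht; have := eql t (ltW ht).
  move=> /(congr1 (fun v => '<| v, y |>)); rewrite inner0l innerDl innerNl innerDl.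
  by rewrite !innerZl => /eqP; rewrite subr_eq0 => /eqP.
Qed.
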